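(* Let $d\ge2$ be an integer, $1<b<\frac{d+1}{d-1}$ and $\lambda\in\operatorname{Arc}[\lambda_0,\lambda_1)$. Then for every $z\in\operatorname{Arc}[\lambda,1]$ there exists $\omega\in\Omega$ such that $z\in J_\omega$ and $$\widehat f^{\,n}_\omega(z)\in\operatorname{Arc}[\lambda,1]\qquad\text{for all }n\in\mathbb N .$$
   Context: $\mathbb S^1$ is the unit circle. For $\alpha,\beta\in\mathbb S^1$, $\operatorname{Arc}[\alpha,\beta]$ is the closed circular arc from $\alpha$ to $\beta$ traversed counterclockwise, with analogous notation for open and half-open arcs. For $1\le k\le d$ let $f_k(z)=f_{k,\lambda}(z)=\lambda\left(\frac{z+b}{bz+1}\right)^k$. Put $\widehat f_d=f_d$ and $\widehat f_k=f_1\circ f_k$ for $1\le k\le d-1$. $\Omega=\{1,\dots,d\}^{\mathbb N}$, and for $\omega=(\omega_1,\omega_2,\dots)\in\Omega$, $\widehat f^{\,n}_{\omega}=\widehat f_{\omega_n}\circ\cdots\circ\widehat f_{\omega_1}$. $J_\omega$ is the Julia set of the sequence $\{\widehat f^{\,n}_\omega\}_n$, i.e. the set of points of $\widehat{\mathbb C}$ having no neighborhood on which this family is normal. $\lambda_0=e^{i\theta_0}\in\mathbb S^1$ is the parameter with the smallest positive angle $\theta_0$ for which $f_{d,\lambda_0}(\lambda_0)=1$; $\lambda_1\in\mathbb S^1$ is the unique parameter with $0<\arg\lambda_1<\pi$ for which $f_{d,\lambda_1}$ has a parabolic fixed point; one has $0<\arg\lambda_0<\arg\lambda_1<\pi$.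 *)

(* Defs.v *)
From Stdlib Require Import Reals Arith.
From Coquelicot Require Import Coquelicot.

Open Scope R_scope.

Definition cis (t : R) : C := (cos t, sin t).

(* Arcs of the unit circle traversed counterclockwise.  The angles satisfy
   s <= s' < s + 2 PI, so that Arc[alpha, alpha] is the single point alpha. *)
Definition Arc_cc (alpha beta z : C) : Prop :=
  exists s s' t : R,
    alpha = cis s /\ beta = cis s' /\ s <= s' < s + 2 * PI /\
    s <= t <= s' /\ z = cis t.

Definition Arc_co (alpha beta z : C) : Prop :=
  exists s s' t : R,
    alpha = cis s /\ beta = cis s' /\ s <= s' < s + 2 * PI /\
    s <= t < s' /\ z = cis t.

Inductive sphere : Type :=
  | Fin (z : C)
  | Infty.

Definition chordal (x y : sphere) : R :=
  match x, y with
  | Fin z, Fin w =>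
      2 * Cmod (z - w) / (sqrt (1 + Cmod z ^ 2) * sqrt (1 + Cmod w ^ 2))
  | Fin z, Infty | Infty, Fin z => 2 / sqrt (1 + Cmod z ^ 2)
  | Infty, Infty => 0
  end.

Definition open_sphere (U : sphere -> Prop) : Prop :=
  forall x, U x -> exists r : R, 0 < r /\ forall y, chordal x y < r -> U y.

(* Uniform convergence, for the chordal metric, near each point of U. *)
Definition cv_loc_unif (U : sphere -> Prop)
    (h : nat -> sphere -> sphere) (g : sphere -> sphere) : Prop :=
  forall x, U x ->
    exists r : R, 0 < r /\
      forall eps : R, 0 < eps ->
        exists N : nat, forall n : nat, (N <= n)%nat ->
          forall y, U y -> chordal x y < r -> chordal (h n y) (g y) < eps.

Definition normal_on (U : sphere -> Prop)
    (F : nat -> sphere -> sphere) : Prop :=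
  forall u : nat -> nat,
    exists (phi : nat -> nat) (g : sphere -> sphere),
      (forall i j : nat, (i < j)%nat -> (phi i < phi j)%nat) /\
      cv_loc_unif U (fun i => F (u (phi i))) g.

Definition Julia (F : nat -> sphere -> sphere) (x : sphere) : Prop :=
  ~ exists U : sphere -> Prop, open_sphere U /\ U x /\ normal_on U F.

(* The value at Infty is a dummy: near a finite fixed point of a continuous
   self-map of the sphere all values are finite. *)
Definition fin_part (x : sphere) : C :=
  match x with Fin z => z | Infty => RtoC 0 end.

Definition sphere_inv (x : sphere) : sphere :=
  match x with
  | Fin z => if Ceq_dec z (RtoC 0) then Infty else Fin (/ z)%C
  | Infty => Fin (RtoC 0)
  end.

(* mu is the multiplier of F at its fixed point p; at Infty it is computed in
   the chart 1/z. *)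
Definition multiplier (F : sphere -> sphere) (p : sphere) (mu : C) : Prop :=
  match p with
  | Fin w =>
      @is_derive C_AbsRing C_NormedModule (fun z => fin_part (F (Fin z))) w mu
  | Infty =>
      @is_derive C_AbsRing C_NormedModule
        (fun z => fin_part (sphere_inv (F (sphere_inv (Fin z))))) (RtoC 0) mu
  end.

Definition parabolic_fixed_point (F : sphere -> sphere) (p : sphere) : Prop :=
  F p = p /\
  exists (mu : C) (m : nat),
    multiplier F p mu /\ (1 <= m)%nat /\ Cpow mu m = RtoC 1.

(* lambda * ((z + b) / (b z + 1)) ^ k on the sphere, for k >= 1 and
   b, lambda <> 0 and b ^ 2 <> 1. *)
Definition fk (b : R) (k : nat) (lambda : C) (x : sphere) : sphere :=
  match x with
  | Fin z =>
      if Ceq_dec (RtoC b * z + 1)%C (RtoC 0) then Infty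
      else Fin (lambda * Cpow ((z + RtoC b) / (RtoC b * z + 1)) k)%C
  | Infty => Fin (lambda * Cpow (/ RtoC b) k)%C
  end.

Definition fhat (b : R) (d k : nat) (lambda : C) (x : sphere) : sphere :=
  if Nat.eqb k d then fk b d lambda x else fk b 1 lambda (fk b k lambda x).

Definition in_Omega (d : nat) (omega : nat -> nat) : Prop :=
  forall i : nat, (1 <= omega i <= d)%nat.

(* omega is indexed from 0: omega i is the letter usually written
   omega_(i+1), and the letter omega 0 is applied first. *)
Fixpoint fhat_iter (b : R) (d : nat) (lambda : C) (omega : nat -> nat)
    (n : nat) (x : sphere) : sphere :=
  match n with
  | O => x
  | S m => fhat b d (omega m) lambda (fhat_iter b d lambda omega m x)
  end.

Definition is_lambda0 (b : R) (d : nat) (lambda0 : C) : Prop :=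
  exists theta0 : R,
    lambda0 = cis theta0 /\
    0 < theta0 /\ fk b d (cis theta0) (Fin (cis theta0)) = Fin (RtoC 1) /\
    forall theta : R,
      0 < theta -> fk b d (cis theta) (Fin (cis theta)) = Fin (RtoC 1) ->
      theta0 <= theta.

Definition is_lambda1 (b : R) (d : nat) (lambda1 : C) : Prop :=
  exists theta1 : R,
    lambda1 = cis theta1 /\ 0 < theta1 < PI /\
    exists p : sphere, parabolic_fixed_point (fk b d lambda1) p.

(* Main.v *)
Require Import Defs.
From Stdlib Require Import Reals Arith ZArith Lra Lia Psatz ClassicalEpsilon.
From Coquelicot Require Import Coquelicot.

(* Write the point z of the unit circle as exp(-i s).  There (z + b)/(b z + 1) = exp(i phi(s))
   for an increasing odd function phi, so f_k becomes s -> -theta - k phi(s), and Arc[lambda, 1]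
   becomes [0, 2 pi - theta] modulo 2 pi.  The half-angle formulas for phi give, for
   s' = f_k(s) and u = phi(s)/2,
     phi'(s) phi'(s') = ((b-1)^2 + 4 b sin(u)^2) / ((b-1)^2 + 4 b cos(theta/2 + k u)^2).
   For k = d and theta0 <= theta < pi this shows that two consecutive steps of f_d expand
   uniformly on the arc, wherever the intermediate point lies; hence a single step of f_d expands
   for the density min(1, c d phi') with a suitable c < 1.  When f_d(s) falls outside the arc,
   one chooses k < d such that f_k(s) is close enough to -1 (or on the right side of it):
   then f_1(f_k(s)) is in the arc and f_1 o f_k expands for the same density.  Following these
   choices, the orbit stays in the arc and is sensitive to initial conditions along the circle,
   so the iterates are not normal near its starting point.
   The parameter lambda1 only enters through theta0 <= arg lambda1 < pi: all fixed points of f_d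
   lie on the circle, and for theta <= theta0 the one in the arc (1, lambda) is attracting. *)

Open Scope R_scope.

(** * The phase function *)

(* |b z + 1|^2 at z = exp(-i s). *)
Definition den2 (b s : R) : R := b ^ 2 + 1 + 2 * b * cos s.

(* (z + b) / (b z + 1) = exp(i (phase b s)) at z = exp(-i s); this formula is a lift to the
   line because z + b stays in the right half-plane. *)
Definition phase (b s : R) : R := s - 2 * atan (sin s / (b + cos s)).

Definition dphase (b s : R) : R := (b ^ 2 - 1) / den2 b s.

Lemma sin2_cos2_pow x : sin x ^ 2 + cos x ^ 2 = 1.
Proof. generalize (sin2_cos2 x); unfold Rsqr; lra. Qed.

Lemma den2_lower b s : 1 < b -> (b - 1) ^ 2 <= den2 b s.
Proof. intros hb; unfold den2; generalize (COS_bound s); nra. Qed.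

Lemma den2_upper b s : 1 < b -> den2 b s <= (b + 1) ^ 2.
Proof. intros hb; unfold den2; generalize (COS_bound s); nra. Qed.

Lemma den2_pos b s : 1 < b -> 0 < den2 b s.
Proof. intros hb; generalize (den2_lower b s hb); nra. Qed.

Lemma cos_half x : cos x = cos (x / 2) ^ 2 - sin (x / 2) ^ 2.
Proof. replace x with (2 * (x / 2)) at 1 by field. rewrite cos_2a; ring. Qed.

Lemma sin_half x : sin x = 2 * sin (x / 2) * cos (x / 2).
Proof. replace x with (2 * (x / 2)) at 1 by field. apply sin_2a. Qed.

Lemma den2_half_sin b s : den2 b s = (b + 1) ^ 2 - 4 * b * sin (s / 2) ^ 2.
Proof.
  unfold den2; rewrite (cos_half s); generalize (sin2_cos2_pow (s / 2)); intros h.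
  replace (cos (s / 2) ^ 2) with (1 - sin (s / 2) ^ 2) by lra; ring.
Qed.

(** The arctangent is the argument of the vector (b + cos s, sin s), which lies in the right
    half-plane and has length [sqrt (den2 b s)]. *)
Lemma sin_cos_atan_arg b s : 1 < b ->
  sin (atan (sin s / (b + cos s))) = sin s / sqrt (den2 b s) /\
  cos (atan (sin s / (b + cos s))) = (b + cos s) / sqrt (den2 b s).
Proof.
  intros hb; rewrite sin_atan, cos_atan.
  assert (hc : 0 < b + cos s) by (generalize (COS_bound s); lra).
  assert (hP := den2_pos b s hb).
  assert (hs : 0 < sqrt (den2 b s)) by (apply sqrt_lt_R0; lra).
  replace (sqrt (1 + (sin s / (b + cos s))²)) with (sqrt (den2 b s) / (b + cos s)).
  - split; field; lra.
  - replace (1 + (sin s / (b + cos s))²) with (den2 b s / (b + cos s) ^ 2).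
    + rewrite sqrt_div by nra. rewrite sqrt_pow2; lra.
    + unfold Rsqr, den2. generalize (sin2_cos2_pow s); intros h.
      replace (b ^ 2 + 1 + 2 * b * cos s) with ((b + cos s) ^ 2 + sin s ^ 2) by nra.
      field; lra.
Qed.

(** With the cosine formula that follows, this is tan(phase/2) = (b-1)/(b+1) tan(s/2), in a form
    that keeps the signs and covers the points where the tangent is infinite. *)
Lemma sin_half_phase b s : 1 < b ->
  sin (phase b s / 2) = (b - 1) * sin (s / 2) / sqrt (den2 b s).
Proof.
  intros hb; destruct (sin_cos_atan_arg b s hb) as [h1 h2]; unfold phase.
  replace ((s - 2 * atan (sin s / (b + cos s))) / 2)
    with (s / 2 - atan (sin s / (b + cos s))) by field.
  rewrite sin_minus, h1, h2, (cos_half s), (sin_half s).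
  assert (hs : 0 < sqrt (den2 b s)) by (apply sqrt_lt_R0, den2_pos; lra).
  generalize (sin2_cos2_pow (s / 2)); intros h.
  transitivity (sin (s / 2) * (b - (sin (s / 2) ^ 2 + cos (s / 2) ^ 2)) / sqrt (den2 b s)).
  field; lra. rewrite h; field; lra.
Qed.

Lemma cos_half_phase b s : 1 < b ->
  cos (phase b s / 2) = (b + 1) * cos (s / 2) / sqrt (den2 b s).
Proof.
  intros hb; destruct (sin_cos_atan_arg b s hb) as [h1 h2]; unfold phase.
  replace ((s - 2 * atan (sin s / (b + cos s))) / 2)
    with (s / 2 - atan (sin s / (b + cos s))) by field.
  rewrite cos_minus, h1, h2, (cos_half s), (sin_half s).
  assert (hs : 0 < sqrt (den2 b s)) by (apply sqrt_lt_R0, den2_pos; lra).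
  generalize (sin2_cos2_pow (s / 2)); intros h.
  transitivity (cos (s / 2) * (b + (sin (s / 2) ^ 2 + cos (s / 2) ^ 2)) / sqrt (den2 b s)).
  field; lra. rewrite h; field; lra.
Qed.

Lemma sin_phase b s : 1 < b -> sin (phase b s) = (b ^ 2 - 1) * sin s / den2 b s.
Proof.
  intros hb; rewrite sin_half, sin_half_phase, cos_half_phase, (sin_half s) by lra.
  assert (hP := den2_pos b s hb).
  assert (hs : 0 < sqrt (den2 b s)) by (apply sqrt_lt_R0; lra).
  rewrite <- (sqrt_sqrt (den2 b s)) at 3 by lra. field; lra.
Qed.

Lemma cos_phase b s : 1 < b ->
  cos (phase b s) = ((b ^ 2 + 1) * cos s + 2 * b) / den2 b s.
Proof.
  intros hb; rewrite cos_half, sin_half_phase, cos_half_phase by lra.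
  assert (hP := den2_pos b s hb).
  assert (hs : 0 < sqrt (den2 b s)) by (apply sqrt_lt_R0; lra).
  transitivity (((b + 1) ^ 2 * cos (s / 2) ^ 2 - (b - 1) ^ 2 * sin (s / 2) ^ 2) / den2 b s).
  - rewrite <- (sqrt_sqrt (den2 b s)) at 3 by lra. field; lra.
  - f_equal. rewrite (cos_half s). generalize (sin2_cos2_pow (s / 2)); intros h.
    replace (2 * b) with (2 * b * (sin (s / 2) ^ 2 + cos (s / 2) ^ 2)) by (rewrite h; ring).
    ring.
Qed.

Lemma sin2_half_phase b s : 1 < b ->
  sin (phase b s / 2) ^ 2 = (b - 1) ^ 2 * sin (s / 2) ^ 2 / den2 b s.
Proof.
  intros hb; rewrite sin_half_phase by lra.
  assert (hP := den2_pos b s hb).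
  assert (hs : 0 < sqrt (den2 b s)) by (apply sqrt_lt_R0; lra).
  rewrite <- (sqrt_sqrt (den2 b s)) at 2 by lra. field; lra.
Qed.

(** Obtained by solving the half-angle formula for [den2 b s]. Having the slope as a function of the
    image angle lets a slope at s and a slope at f_k(s) be compared through the single variable u =
    phase(s)/2. *)
Lemma dphase_half_phase b s : 1 < b ->
  dphase b s = ((b - 1) ^ 2 + 4 * b * sin (phase b s / 2) ^ 2) / (b ^ 2 - 1).
Proof.
  intros hb; unfold dphase; rewrite sin2_half_phase by lra.
  assert (hP := den2_pos b s hb).
  replace (sin (s / 2) ^ 2) with (((b + 1) ^ 2 - den2 b s) / (4 * b))
    by (rewrite den2_half_sin; field; lra).
  field; repeat split; nra.
Qed.

Lemma is_derive_phase b s : 1 < b -> is_derive (phase b) s (dphase b s).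
Proof.
  intros hb; unfold phase, dphase.
  assert (hc : 0 < b + cos s) by (generalize (COS_bound s); lra).
  auto_derive; [lra|].
  generalize (den2_pos b s hb); unfold den2; intros hP.
  generalize (sin2_cos2_pow s); intros h.
  replace (1 + sin s * / (b + cos s) * (sin s * / (b + cos s) * 1))
    with ((b ^ 2 + 1 + 2 * b * cos s) / (b + cos s) ^ 2).
  - replace (cos s * (b + cos s)) with (b * cos s + (1 - sin s ^ 2)) by nra. 
    field_simplify_eq; [nra | lra].
  - replace (b ^ 2 + 1 + 2 * b * cos s) with ((b + cos s) ^ 2 + sin s ^ 2) by nra.
    field; lra.
Qed.

Lemma dphase_pos b s : 1 < b -> 0 < dphase b s.
Proof. intros hb; apply Rdiv_lt_0_compat; [nra | apply den2_pos; lra]. Qed.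

Lemma phase_mvt b x y : 1 < b -> x < y ->
  exists c, x < c < y /\ phase b y - phase b x = dphase b c * (y - x).
Proof.
  intros hb hxy.
  destruct (MVT_cor2 (phase b) (dphase b) x y hxy) as [c [h1 h2]].
  - intros c _; apply is_derive_Reals, is_derive_phase, hb.
  - exists c; split; assumption.
Qed.

Lemma phase_incr b x y : 1 < b -> x < y -> phase b x < phase b y.
Proof.
  intros hb hxy; destruct (phase_mvt b x y hb hxy) as [c [_ h]].
  generalize (dphase_pos b c hb); nra.
Qed.

Lemma phase_incr_le b x y : 1 < b -> x <= y -> phase b x <= phase b y.
Proof.
  intros hb [hxy | ->]; [left; apply phase_incr; lra | lra].
Qed.

Lemma phase_0 b : phase b 0 = 0.
Proof. unfold phase; rewrite sin_0; unfold Rdiv; rewrite Rmult_0_l, atan_0; ring. Qed.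

Lemma phase_PI b : phase b PI = PI.
Proof. unfold phase; rewrite sin_PI; unfold Rdiv; rewrite Rmult_0_l, atan_0; ring. Qed.

Lemma phase_opp b s : phase b (- s) = - phase b s.
Proof.
  unfold phase; rewrite sin_neg, cos_neg.
  replace (- sin s / (b + cos s)) with (- (sin s / (b + cos s))) by (unfold Rdiv; ring).
  rewrite atan_opp; ring.
Qed.

Lemma cos_period_Z s j : cos (s + 2 * IZR j * PI) = cos s.
Proof.
  destruct (Z_le_gt_dec 0 j) as [h | h].
  - rewrite <- (Z2Nat.id j h), <- INR_IZR_INZ. apply cos_period.
  - rewrite <- (cos_period (s + 2 * IZR j * PI) (Z.to_nat (- j))).
    f_equal. rewrite INR_IZR_INZ, Z2Nat.id, opp_IZR by lia. ring.
Qed.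

Lemma sin_period_Z s j : sin (s + 2 * IZR j * PI) = sin s.
Proof.
  destruct (Z_le_gt_dec 0 j) as [h | h].
  - rewrite <- (Z2Nat.id j h), <- INR_IZR_INZ. apply sin_period.
  - rewrite <- (sin_period (s + 2 * IZR j * PI) (Z.to_nat (- j))).
    f_equal. rewrite INR_IZR_INZ, Z2Nat.id, opp_IZR by lia. ring.
Qed.

Lemma phase_period b s j : phase b (s + 2 * IZR j * PI) = phase b s + 2 * IZR j * PI.
Proof. unfold phase; rewrite sin_period_Z, cos_period_Z; ring. Qed.

Lemma dphase_period b s j : dphase b (s + 2 * IZR j * PI) = dphase b s.
Proof. unfold dphase, den2; rewrite cos_period_Z; reflexivity. Qed.

Lemma dphase_le_cos b s t : 1 < b -> cos t <= cos s -> dphase b s <= dphase b t.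
Proof.
  intros hb h; unfold dphase; apply Rmult_le_compat_l; [nra|].
  apply Rinv_le_contravar; [apply den2_pos; lra | unfold den2; nra].
Qed.

Lemma dphase_mono b s t : 1 < b -> 0 <= s <= t -> t <= PI -> dphase b s <= dphase b t.
Proof. intros hb h1 h2; apply dphase_le_cos; [lra | apply cos_decr_1; lra]. Qed.

Lemma dphase_opp b s : dphase b (- s) = dphase b s.
Proof. unfold dphase, den2; rewrite cos_neg; reflexivity. Qed.

(** * The parameter lambda0 *)

Lemma sin_mult_sqr_le n x : sin (INR n * x) ^ 2 <= INR n ^ 2 * sin x ^ 2.
Proof.
  assert (h : Rabs (sin (INR n * x)) <= INR n * Rabs (sin x)).
  { induction n as [|n IH].
    - simpl; rewrite !Rmult_0_l, sin_0, Rabs_R0; lra.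
    - rewrite S_INR. replace ((INR n + 1) * x) with (INR n * x + x) by ring.
      rewrite sin_plus. eapply Rle_trans; [apply Rabs_triang|].
      rewrite !Rabs_mult.
      assert (h1 : Rabs (cos x) <= 1) by (apply Rabs_le, COS_bound).
      assert (h2 : Rabs (cos (INR n * x)) <= 1) by (apply Rabs_le, COS_bound).
      generalize (Rabs_pos (sin (INR n * x))) (Rabs_pos (sin x))
        (Rabs_pos (cos x)) (Rabs_pos (cos (INR n * x))); intros.
      nra. }
  rewrite <- (pow2_abs (sin (INR n * x))), <- (pow2_abs (sin x)), <- Rpow_mult_distr.
  apply pow_incr; split; [apply Rabs_pos | exact h].
Qed.

(** Strictness comes from the last use of the addition formula: |cos x| < 1 on the open interval,
    or, if sin(m x) = 0, one of the m + 1 copies of sin x is enough. *)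
Lemma sin_mult_sqr_lt n x : (2 <= n)%nat -> 0 < x < PI ->
  sin (INR n * x) ^ 2 < INR n ^ 2 * sin x ^ 2.
Proof.
  intros hn hx. destruct n as [|[|n]]; [lia | lia |].
  assert (hs : 0 < sin x) by (apply sin_gt_0; lra).
  rewrite S_INR. set (m := S n).
  replace ((INR m + 1) * x) with (INR m * x + x) by ring.
  rewrite sin_plus.
  assert (hm : 1 <= INR m) by (unfold m; rewrite S_INR; generalize (pos_INR n); lra).
  assert (h1 := sin_mult_sqr_le m x).
  assert (hA := sin2_cos2_pow (INR m * x)). assert (hB := sin2_cos2_pow x).
  set (A := sin (INR m * x)) in *. set (A' := cos (INR m * x)) in *.
  set (B := sin x) in *. set (B' := cos x) in *. set (k := INR m) in *.
  assert (h2 : Rabs A <= k * B).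
  { apply Rnot_lt_le; intros hc. assert (0 <= k * B) by nra.
    assert ((k * B) ^ 2 < Rabs A ^ 2) by nra.
    rewrite pow2_abs in *. nra. }
  assert (h3 : Rabs (A * B' + A' * B) < (k + 1) * B).
  { eapply Rle_lt_trans; [apply Rabs_triang|]. rewrite !Rabs_mult, (Rabs_pos_eq B) by lra.
    assert (hc : Rabs B' < 1) by (apply Rabs_def1; nra).
    assert (hc' : Rabs A' <= 1) by (apply Rabs_le; split; nra).
    generalize (Rabs_pos A) (Rabs_pos A') (Rabs_pos B'); intros.
    destruct (Req_dec (Rabs A) 0) as [e|e]; nra. }
  rewrite <- Rpow_mult_distr, <- (pow2_abs (A * B' + A' * B)).
  generalize (Rabs_pos (A * B' + A' * B)); nra.
Qed.

Lemma sin_div_le n x : (1 <= n)%nat -> sin x ^ 2 <= INR n ^ 2 * sin (x / INR n) ^ 2.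
Proof.
  intros hn. replace x with (INR n * (x / INR n)) at 1.
  apply sin_mult_sqr_le. field. apply not_0_INR; lia.
Qed.

(** This is n cot(n y) < cot y with the denominators cleared, by induction from the duplication
    formula. *)
Lemma cot_mult_lt n y : (2 <= n)%nat -> 0 < y -> INR n * y < PI ->
  INR n * cos (INR n * y) * sin y < cos y * sin (INR n * y).
Proof.
  intros hn hy. destruct n as [|[|n]]; [lia | lia |]. clear hn.
  assert (hh : INR (S (S n)) * y < PI -> 0 < sin y /\ 0 < cos y).
  { rewrite !S_INR; generalize (pos_INR n); intros h1 h2.
    assert (2 * y < PI) by nra. split; [apply sin_gt_0 | apply cos_gt_0]; lra. }
  induction n as [|n IH]; intros hlt.
  - destruct (hh hlt) as [hs hc].
    replace (INR 2) with 2 by (simpl; ring). rewrite sin_2a, cos_2a.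
    generalize (sin2_cos2_pow y); intros e.
    assert (0 < sin y ^ 2) by nra. assert (0 < sin y ^ 3) by (apply pow_lt; lra). nra.
  - destruct (hh hlt) as [hs hc].
    assert (hlt' : INR (S (S n)) * y < PI).
    { rewrite (S_INR (S (S n))) in hlt; nra. }
    assert (IH' := IH (fun _ => conj hs hc) hlt').
    rewrite (S_INR (S (S n))). set (k := INR (S (S n))) in *.
    assert (hk : 0 < k) by (apply lt_0_INR; lia).
    replace ((k + 1) * y) with (k * y + y) by ring.
    rewrite sin_plus, cos_plus.
    assert (hks : 0 < sin (k * y)) by (apply sin_gt_0; nra).
    (* By the addition formulas, the gap between the two sides at k + 1 is exactly the sum of this
       term and the next one. *)
    assert (0 < cos y * (cos y * sin (k * y) - k * cos (k * y) * sin y)) by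
      (apply Rmult_lt_0_compat; lra).
    assert (0 < (k + 1) * sin y ^ 2 * sin (k * y)).
    { apply Rmult_lt_0_compat; [|lra]. apply Rmult_lt_0_compat; nra. }
    nra.
Qed.

(** * The maps f_k on the unit circle *)

Lemma cis_period t j : cis (t + 2 * IZR j * PI) = cis t.
Proof. unfold cis; rewrite sin_period_Z, cos_period_Z; reflexivity. Qed.

Lemma cis_inj x y : cis x = cis y -> exists j : Z, x = y + 2 * IZR j * PI.
Proof.
  unfold cis; intros h; injection h; intros hs hc.
  assert (h1 : cos (x - y) = 1).
  { rewrite cos_minus, hs, hc; generalize (sin2_cos2_pow y); lra. }
  assert (h2 : sin ((x - y) / 2) = 0).
  { rewrite cos_half in h1. generalize (sin2_cos2_pow ((x - y) / 2)); nra. }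
  destruct (sin_eq_0_0 _ h2) as [j hj]. exists j. lra.
Qed.

Lemma cis_add x y : cis (x + y) = (cis x * cis y)%C.
Proof. unfold cis, Cmult; simpl; rewrite cos_plus, sin_plus; f_equal; ring. Qed.

Lemma cis_0 : cis 0 = RtoC 1.
Proof. unfold cis; rewrite cos_0, sin_0; reflexivity. Qed.

Lemma cis_pow x k : Cpow (cis x) k = cis (INR k * x).
Proof.
  induction k as [|k IH].
  - simpl; rewrite Rmult_0_l, cis_0; reflexivity.
  - rewrite S_INR; simpl Cpow; rewrite IH, <- cis_add; f_equal; ring.
Qed.

Lemma Cmod_cis t : Cmod (cis t) = 1.
Proof.
  unfold Cmod, cis; simpl fst; simpl snd.
  replace (cos t ^ 2 + sin t ^ 2) with 1 by (generalize (sin2_cos2_pow t); lra).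
  apply sqrt_1.
Qed.

Lemma den_cis_neq_0 b s : 1 < b -> (RtoC b * cis (- s) + 1)%C <> RtoC 0.
Proof.
  intros hb h. unfold cis, Cmult, Cplus, RtoC in h; simpl in h.
  injection h; intros h1 h2.
  rewrite sin_neg in h1; rewrite cos_neg in h2.
  generalize (sin2_cos2_pow s); intros e.
  assert (sin s = 0) by nra. assert (b * cos s = -1) by lra.
  generalize (COS_bound s); nra.
Qed.

Lemma mobius_cis b s : 1 < b ->
  ((cis (- s) + RtoC b) / (RtoC b * cis (- s) + 1))%C = cis (phase b s).
Proof.
  intros hb. assert (hn := den_cis_neq_0 b s hb).
  assert (e : (cis (- s) + RtoC b)%C = (cis (phase b s) * (RtoC b * cis (- s) + 1))%C).
  { unfold cis, Cmult, Cplus, RtoC; simpl.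
    rewrite sin_phase, cos_phase, sin_neg, cos_neg by lra.
    assert (hP := den2_pos b s hb).
    generalize (sin2_cos2_pow s); intros e.
    f_equal; unfold den2 in *; field_simplify_eq; try lra;
     replace (cos s ^ 2) with (1 - sin s ^ 2) by lra; ring. }
  rewrite e. field. exact hn.
Qed.

(** The pole -1/b is off the circle, so the infinite branch never occurs there; on the circle f_k is
    the real map s -> -theta - k phase(s). *)
Lemma fk_cis b k th s : 1 < b ->
  fk b k (cis th) (Fin (cis (- s))) = Fin (cis (- (- th - INR k * phase b s))).
Proof.
  intros hb; unfold fk. destruct Ceq_dec as [e|e].
  - exfalso; apply (den_cis_neq_0 b s hb e).
  - rewrite mobius_cis, cis_pow, <- cis_add by lra. f_equal; f_equal; ring.
Qed.

(** The bound on b, written without division, says that d phase'(0) = d (b-1)/(b+1) is less than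
    1. *)
Record admissible (b : R) (d : nat) : Prop := {
  admissible_d : (2 <= d)%nat;
  admissible_b : 1 < b;
  admissible_bd : INR d * (b - 1) < b + 1
}.

Lemma admissible_intro b d : (2 <= d)%nat -> 1 < b < (INR d + 1) / (INR d - 1) -> admissible b d.
Proof.
  intros hd [h1 h2]. assert (hd' : 2 <= INR d) by (apply (le_INR 2); lia).
  split; [lia | lra |].
  apply (Rmult_lt_compat_r (INR d - 1)) in h2; [|lra].
  replace ((INR d + 1) / (INR d - 1) * (INR d - 1)) with (INR d + 1) in h2 by (field; lra).
  nra.
Qed.

Lemma admissible_INR b d : admissible b d -> 2 <= INR d.
Proof. intros [h _ _]; apply (le_INR 2); lia. Qed.

(** The slope of d phase at 0 is below 1 and is continuous, so the mean value theorem puts the graph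
    of d phase below the diagonal just to the right of 0. *)
Lemma phase_small b d m : admissible b d -> 0 < m ->
  exists x, 0 < x < m /\ INR d * phase b x < x.
Proof.
  intros hp hm. destruct (hp) as [_ hb hbd]. assert (hd := admissible_INR b d hp).
  assert (hcont : continuity_pt (fun x => INR d * dphase b x) 0).
  { apply derivable_continuous_pt, ex_derive_Reals_0. unfold dphase, den2. auto_derive.
    rewrite cos_0. nra. }
  (* With the gap to 1 as tolerance, d phase' stays below 1 on the whole neighbourhood. *)
  destruct (hcont (1 - INR d * dphase b 0)) as [al [hal h]].
  { unfold dphase, den2; rewrite cos_0.
    cut (INR d * ((b ^ 2 - 1) / (b ^ 2 + 1 + 2 * b * 1)) < 1); [lra|]. apply Rmult_lt_reg_r with ((b+1)^2). nra.
    replace (INR d * ((b ^ 2 - 1) / (b ^ 2 + 1 + 2 * b * 1)) * (b + 1) ^ 2)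
      with (INR d * (b - 1) * (b + 1)). nra.
    field. nra. }
  exists (Rmin (al / 2) (m / 2)).
  set (x := Rmin (al / 2) (m / 2)).
  assert (hx : 0 < x) by (apply Rmin_pos; lra).
  assert (hx1 := Rmin_l (al / 2) (m / 2)). assert (hx2 := Rmin_r (al / 2) (m / 2)).
  fold x in hx1, hx2. split; [lra|].
  destruct (phase_mvt b 0 x hb hx) as [c [hc e]].
  rewrite phase_0 in e. replace (phase b x) with (dphase b c * x) by lra.
  assert (hh : INR d * dphase b c < 1).
  { specialize (h c). simpl in h. unfold R_dist in h.
    assert (hc' : Rabs (INR d * dphase b c - INR d * dphase b 0) < 1 - INR d * dphase b 0).
    { apply h; split. split; [exact I | lra]. rewrite Rabs_pos_eq; lra. }
    apply Rabs_lt_between in hc'. lra. }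
  nra.
Qed.

Lemma phase_defect_root b d x y : 1 < b -> 0 < x <= y ->
  INR d * phase b x <= x -> y <= INR d * phase b y ->
  exists z, x <= z <= y /\ z = INR d * phase b z.
Proof.
  intros hb hxy h1 h2.
  destruct (IVT_cor (fun z => INR d * phase b z - z) x y) as [z [hz e]].
  - intros t. apply derivable_continuous_pt, ex_derive_Reals_0.
    apply @ex_derive_minus; [|apply ex_derive_id].
    apply ex_derive_scal. eexists; apply is_derive_phase; lra.
  - lra.
  - nra.
  - exists z; split; lra.
Qed.

(** The condition f_d(lambda0) = 1 only makes t0 - d phase(t0) a multiple of 2 pi; here that
    multiple is zero. *)
Record theta0_spec (b : R) (d : nat) (t0 : R) : Prop := {
  theta0_range : 0 < t0 < PI;
  theta0_eq : t0 = INR d * phase b t0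
}.

Lemma fk_self_eq_1 b d t : 1 < b ->
  fk b d (cis t) (Fin (cis t)) = Fin (RtoC 1) <->
  exists j : Z, t - INR d * phase b t = 2 * IZR j * PI.
Proof.
  intros hb. replace (Fin (cis t)) with (Fin (cis (- - t))) by (f_equal; f_equal; ring).
  rewrite fk_cis, phase_opp by lra.
  replace (- (- t - INR d * - phase b t)) with (t - INR d * phase b t) by ring.
  rewrite <- cis_0. split.
  - intros h; injection h; intros h1 h2.
    destruct (cis_inj (t - INR d * phase b t) 0) as [j hj].
    unfold cis; rewrite h1, h2; reflexivity. exists j; lra.
  - intros [j hj]. rewrite hj. replace (2 * IZR j * PI) with (0 + 2 * IZR j * PI) by ring.
    rewrite cis_period; reflexivity.
Qed.

(** The graph of d phase is below the diagonal near 0 and above it at pi, so it crosses it before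
    pi, and minimality gives t0 < pi. The multiple of 2 pi cannot be positive because t0 < 2 pi. *)
Lemma is_lambda0_spec b d l : admissible b d -> is_lambda0 b d l ->
  exists t0, l = cis t0 /\ theta0_spec b d t0.
Proof.
  intros hp (t0 & hl & hpos & heq & hmin). destruct (hp) as [hd2 hb hbd].
  assert (hd := admissible_INR b d hp). assert (hpi := PI_RGT_0).
  assert (hroot : forall z, 0 < z -> z = INR d * phase b z -> t0 <= z).
  { intros z hz e. apply hmin; [lra|]. apply fk_self_eq_1; [lra|].
    exists 0%Z; lra. }
  assert (hlt : t0 < PI).
  { destruct (phase_small b d PI hp hpi) as [x [hx hx']].
    destruct (phase_defect_root b d x PI) as [z [hz e]]; try lra.
    { rewrite phase_PI; nra. }
    assert (h := hroot z ltac:(lra) e).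
    destruct (Req_dec z PI) as [->|]; [|lra].
    rewrite phase_PI in e. nra. }
  exists t0; split; [assumption|]; split; [lra|].
  apply fk_self_eq_1 in heq; [|lra]. destruct heq as [j hj].
  assert (hph : 0 <= phase b t0).
  { rewrite <- (phase_0 b); apply phase_incr_le; lra. }
  assert (hj0 : (j <= 0)%Z).
  { apply Znot_gt_le; intros hgt. assert (1 <= IZR j) by (apply IZR_le; lia).
    assert (0 <= INR d * phase b t0) by nra. nra. }
  (* If j were negative, d phase would lie strictly above the diagonal at t0 and would have crossed
     it earlier, against minimality. *)
  destruct (Z.eq_dec j 0) as [->|hne]; [lra|].
  assert (hj1 : IZR j <= -1) by (apply IZR_le; lia).
  destruct (phase_small b d t0 hp hpos) as [x [hx hx']].
  destruct (phase_defect_root b d x t0) as [z [hz e]]; try lra; try nra.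
  assert (h := hroot z ltac:(lra) e).
  assert (z = t0) by lra. subst z. nra.
Qed.

Lemma phase_chord_dphase b d t0 : admissible b d -> theta0_spec b d t0 ->
  exists c, 0 < c < t0 /\ INR d * dphase b c = 1.
Proof.
  intros hp [hr he]. destruct (hp) as [_ hb _].
  destruct (phase_mvt b 0 t0 hb ltac:(lra)) as [c [hc e]]. rewrite phase_0 in e.
  exists c; split; [lra|]. apply Rmult_eq_reg_r with t0; [|lra].
  replace (INR d * dphase b c * t0) with (INR d * phase b t0); [lra|].
  replace (phase b t0) with (dphase b c * t0) by lra. ring.
Qed.

(** The slope of d phase equals 1 somewhere before t0 and increases up to pi, so beyond t0 the graph
    cannot come back below the diagonal. *)
Lemma phase_above b d t0 t : admissible b d -> theta0_spec b d t0 -> t0 <= t <= PI ->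
  t <= INR d * phase b t.
Proof.
  intros hp h0 ht. destruct (phase_chord_dphase b d t0 hp h0) as [c [hc e]].
  destruct h0 as [hr he]. destruct (hp) as [_ hb _]. assert (hd := admissible_INR b d hp).
  destruct (Req_dec t t0) as [->|hne]; [lra|].
  destruct (phase_mvt b t0 t hb ltac:(lra)) as [c' [hc' e']].
  assert (dphase b c <= dphase b c') by (apply dphase_mono; lra).
  assert (1 <= INR d * dphase b c') by nra. nra.
Qed.

(* The 2-cycle 1 -> lambda0 -> 1 of f_d is repelling. *)
Lemma theta0_repelling b d t0 : admissible b d -> theta0_spec b d t0 ->
  den2 b t0 < INR d ^ 2 * (b - 1) ^ 2.
Proof.
  intros hp [hr he]. destruct (hp) as [hd2 hb _]. assert (hd := admissible_INR b d hp).
  assert (hP := den2_pos b t0 hb).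
  (* Since t0 = d phase(t0), this compares sin(t0/2) with sin(phase(t0)/2); the half-angle formula
     then lets the factor sin(t0/2)^2 cancel. *)
  assert (hlt := sin_mult_sqr_lt d (phase b t0 / 2) hd2).
  replace (INR d * (phase b t0 / 2)) with (t0 / 2) in hlt by lra.
  assert (hph : 0 < phase b t0) by nra.
  specialize (hlt ltac:(nra)).
  assert (e : sin (phase b t0 / 2) ^ 2 = (b - 1) ^ 2 * sin (t0 / 2) ^ 2 / den2 b t0)
    by (apply sin2_half_phase; lra).
  rewrite e in hlt.
  assert (hs : 0 < sin (t0 / 2)) by (apply sin_gt_0; lra).
  assert (hs2 : 0 < sin (t0 / 2) ^ 2) by nra.
  apply Rmult_lt_reg_r with (sin (t0 / 2) ^ 2 / den2 b t0).
  - apply Rdiv_lt_0_compat; lra.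
  - replace (den2 b t0 * (sin (t0 / 2) ^ 2 / den2 b t0)) with (sin (t0 / 2) ^ 2) by (field; lra).
    lra.
Qed.

(** * The parameter lambda1 *)

(* For theta = t0, f_d contracts the hyperbolic metric of the arc (0, t0), which it maps onto itself;
   in half angles this is the inequality d cot (d y) < cot y. *)
Lemma dphase_fixed_lt b d t0 x : admissible b d -> theta0_spec b d t0 -> 0 < x < t0 ->
  x + INR d * phase b x = t0 -> INR d * dphase b x < 1.
Proof.
  intros hp [hr he] hx hfix. destruct (hp) as [hd2 hb _].
  assert (hd := admissible_INR b d hp).
  assert (hPx := den2_pos b x hb). assert (hP0 := den2_pos b t0 hb).
  assert (hqx : 0 < sqrt (den2 b x)) by (apply sqrt_lt_R0; lra).
  assert (hq0 : 0 < sqrt (den2 b t0)) by (apply sqrt_lt_R0; lra).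
  assert (hphx : 0 < phase b x) by (rewrite <- (phase_0 b); apply phase_incr; lra).
  assert (hphx' : phase b x < phase b t0) by (apply phase_incr; lra).
  set (a := phase b x / 2). set (e := phase b t0 / 2).
  set (h := x / 2). set (T := t0 / 2).
  assert (ha : INR d * a = T - h) by (unfold a, T, h; lra).
  assert (hea : INR d * (e - a) = h) by (unfold a, e, h; lra).
  assert (h1 := cot_mult_lt d a hd2 ltac:(unfold a; lra)).
  assert (h2 := cot_mult_lt d (e - a) hd2 ltac:(unfold e, a; lra)).
  rewrite ha in h1. rewrite hea in h2.
  specialize (h1 ltac:(unfold T, h; lra)). specialize (h2 ltac:(unfold h; lra)).
  assert (hde : INR d * e = T) by lra.
  assert (haR : 0 < a < PI) by (unfold a; nra).
  assert (heaR : 0 < e - a < PI) by (unfold e, a; nra).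
  assert (sa : 0 < sin a) by (apply sin_gt_0; lra).
  assert (sea : 0 < sin (e - a)) by (apply sin_gt_0; lra).
  assert (sh : 0 < sin h) by (apply sin_gt_0; unfold h; lra).
  assert (sTh : 0 < sin (T - h)) by (apply sin_gt_0; unfold T, h; lra).
  assert (sT : 0 < sin T) by (apply sin_gt_0; unfold T; lra).
  (* The sum of d cot(T-h) < cot a and d cot h < cot(e-a), over common denominators; the addition
     formula recombines each side. *)
  assert (key : INR d * (sin T * (sin a * sin (e - a))) < sin e * (sin h * sin (T - h))).
  { replace T with ((T - h) + h) at 1 by ring.
    replace e with (a + (e - a)) at 2 by ring.
    rewrite sin_plus, (sin_plus a (e - a)).
    assert (k1 := Rmult_lt_compat_r (sin h * sin (e - a)) _ _ ltac:(nra) h1).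
    assert (k2 := Rmult_lt_compat_r (sin (T - h) * sin a) _ _ ltac:(nra) h2).
    nra. }
  assert (E1 : sin a = (b - 1) * sin h / sqrt (den2 b x)) by (apply sin_half_phase; lra).
  assert (E2 : cos a = (b + 1) * cos h / sqrt (den2 b x)) by (apply cos_half_phase; lra).
  assert (E3 : sin e = (b - 1) * sin T / sqrt (den2 b t0)) by (apply sin_half_phase; lra).
  assert (E4 : cos e = (b + 1) * cos T / sqrt (den2 b t0)) by (apply cos_half_phase; lra).
  assert (E5 : sin (e - a) = (b ^ 2 - 1) * sin (T - h) / (sqrt (den2 b x) * sqrt (den2 b t0))).
  { rewrite sin_minus, E1, E2, E3, E4, sin_minus. field. lra. }
  rewrite E1, E5, E3 in key.
  (* Dividing [key] by this common factor leaves d (b^2-1) / den2(x) < 1. *)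
  assert (hpos : 0 < (b - 1) * sin T * sin h * sin (T - h) / sqrt (den2 b t0)).
  { apply Rdiv_lt_0_compat; [|lra]. repeat apply Rmult_lt_0_compat; lra. }
  apply Rmult_lt_reg_r with (1 := hpos).
  unfold dphase. rewrite <- (sqrt_sqrt (den2 b x)) by lra.
  eapply Rle_lt_trans; [|eapply Rlt_le_trans; [exact key|]]; right; field; lra.
Qed.

(** The first bound holds because the slope increases up to t. For the second, sin(phase) = phase'
    sin t gives d sin(phase(t)) = sin(pi-t) <= d sin((pi-t)/d), and the sine increases on the range
    in question. *)
Lemma phase_at_neutral b d t : admissible b d -> 0 < t < PI -> INR d * dphase b t = 1 ->
  INR d * phase b t <= t /\ t + INR d * phase b t <= PI.
Proof.
  intros hp ht h. destruct (hp) as [hd2 hb _]. assert (hd := admissible_INR b d hp).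
  assert (hle : INR d * phase b t <= t).
  { destruct (phase_mvt b 0 t hb ltac:(lra)) as [c [hc e]]. rewrite phase_0 in e.
    assert (dphase b c <= dphase b t) by (apply dphase_mono; lra).
    replace (phase b t) with (dphase b c * t) by lra.
    assert (INR d * dphase b c <= 1) by nra. nra. }
  split; [exact hle|]. apply Rnot_lt_le; intros hgt.
  set (w := PI - t).
  assert (hsin : INR d * sin (phase b t) = sin w).
  { assert (hP := den2_pos b t hb).
    rewrite sin_phase by lra. unfold w. rewrite sin_PI_x.
    transitivity (INR d * dphase b t * sin t); [unfold dphase; field; lra|].
    rewrite h; ring. }
  assert (hw := sin_div_le d w ltac:(lia)).
  assert (hwd : w / INR d < phase b t).
  { apply Rmult_lt_reg_l with (INR d); [lra|].
    replace (INR d * (w / INR d)) with w by (field; lra). unfold w; lra. }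
  assert (hw0 : 0 < w / INR d) by (apply Rdiv_lt_0_compat; unfold w; lra).
  assert (hph : phase b t < PI / 2).
  { assert (0 < phase b t) by lra. nra. }
  assert (s1 : 0 < sin (w / INR d)) by (apply sin_gt_0; lra).
  assert (s2 : sin (w / INR d) < sin (phase b t)) by (apply sin_increasing_1; lra).
  rewrite <- hsin, Rpow_mult_distr in hw.
  assert (sin (w / INR d) ^ 2 < sin (phase b t) ^ 2) by nra.
  assert (0 < INR d ^ 2) by nra. nra.
Qed.

(** The sum t + d phase(t) is the parameter angle for which -t is a fixed coordinate of f_d. Were it
    below t0, the fixed point x for the angle t0 would lie in (t, t0), where the slope is at least
    the neutral one, against [dphase_fixed_lt]. *)
Lemma neutral_param_ge b d t0 t : admissible b d -> theta0_spec b d t0 ->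
  0 < t < PI -> INR d * dphase b t = 1 -> t0 <= t + INR d * phase b t.
Proof.
  intros hp h0 ht h. apply Rnot_lt_le; intros hlt.
  destruct (h0) as [hr he]. destruct (hp) as [hd2 hb _]. assert (hd := admissible_INR b d hp).
  assert (hpt : 0 < phase b t) by (rewrite <- (phase_0 b); apply phase_incr; lra).
  destruct (IVT_cor (fun z => z + INR d * phase b z - t0) t t0) as [x [hx e]].
  - intros z. apply derivable_continuous_pt, ex_derive_Reals_0.
    apply @ex_derive_minus; [|apply ex_derive_const].
    apply @ex_derive_plus; [apply ex_derive_id|].
    apply ex_derive_scal. eexists; apply is_derive_phase; lra.
  - nra.
  - nra.
  - assert (hxt : t <> x) by (intros <-; lra).
    assert (hx0 : x <> t0) by (intros ->; lra).
    assert (dphase b t <= dphase b x) by (apply dphase_mono; lra).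
    assert (INR d * dphase b x < 1)
      by (apply (dphase_fixed_lt b d t0 x hp h0); lra).
    nra.
Qed.

Lemma Cmod_pow z n : Cmod (Cpow z n) = Cmod z ^ n.
Proof.
  induction n as [|n IH]; simpl; [apply Cmod_1 | rewrite Cmod_mult, IH; reflexivity].
Qed.

Lemma unit_cis z : Cmod z = 1 -> exists s, - PI <= s <= PI /\ z = cis (- s).
Proof.
  destruct z as [x y]; unfold Cmod; simpl fst; simpl snd; intros h.
  assert (h2 : x ^ 2 + y ^ 2 = 1).
  { rewrite <- (sqrt_sqrt (x ^ 2 + y ^ 2)) by nra. rewrite h; ring. }
  assert (hx : -1 <= x <= 1) by nra.
  assert (hb := acos_bound x).
  assert (hs : sin (acos x) = sqrt (y ^ 2)).
  { rewrite sin_acos by lra. f_equal. unfold Rsqr; lra. }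
  destruct (Rle_dec 0 y) as [hy|hy].
  - exists (- acos x); split; [lra|]. unfold cis. rewrite Ropp_involutive, hs, cos_acos by lra.
    rewrite sqrt_pow2 by lra; reflexivity.
  - exists (acos x); split; [lra|]. unfold cis. rewrite cos_neg, sin_neg, hs, cos_acos by lra.
    replace (y ^ 2) with ((- y) ^ 2) by ring. rewrite sqrt_pow2 by lra. f_equal; ring.
Qed.

(* f_d exchanges the two sides of the unit circle, so it has no fixed point off it. *)
Lemma fk_fixed_unit b d th p : admissible b d -> fk b d (cis th) p = p ->
  exists s, - PI <= s <= PI /\ p = Fin (cis (- s)).
Proof.
  intros [hd2 hb _] h. destruct p as [z|]; [|discriminate h].
  unfold fk in h. destruct Ceq_dec as [|hn]; [discriminate h|].
  injection h as h.
  assert (hz : Cmod z = 1).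
  { apply (f_equal Cmod) in h. rewrite Cmod_mult, Cmod_cis, Cmod_pow, Rmult_1_l, Cmod_div in h
      by exact hn.
    set (A := Cmod (z + RtoC b)%C) in *. set (B := Cmod (RtoC b * z + 1)%C) in *.
    assert (hB : 0 < B) by (apply Cmod_gt_0; exact hn).
    assert (hA : 0 <= A) by apply Cmod_ge_0.
    (* This identity decides on which side of 1 the modulus of f_d(z) lies. *)
    assert (hAB : A ^ 2 - B ^ 2 = (b ^ 2 - 1) * (1 - Cmod z ^ 2)).
    { unfold A, B, Cmod. rewrite !pow2_sqrt by nra.
      destruct z as [x y]; simpl; ring. }
    assert (hm := Cmod_ge_0 z).
    destruct (Rtotal_order (Cmod z) 1) as [hlt | [e | hgt]]; [exfalso | exact e | exfalso].
    - assert (0 < A ^ 2 - B ^ 2) by (rewrite hAB; apply Rmult_lt_0_compat; nra).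
      assert (B < A) by nra.
      assert (1 <= (A / B) ^ d).
      { apply pow_R1_Rle. apply Rmult_le_reg_r with B; [lra|].
        replace (A / B * B) with A by (field; lra). lra. }
      lra.
    - assert (0 < B ^ 2 - A ^ 2).
      { replace (B ^ 2 - A ^ 2) with ((b ^ 2 - 1) * (Cmod z ^ 2 - 1)) by lra.
        apply Rmult_lt_0_compat; nra. }
      assert (A < B) by nra.
      assert ((A / B) ^ d <= 1 ^ d).
      { apply pow_incr; split; [apply Rle_div_r; lra|].
        apply Rmult_le_reg_r with B; [lra|].
        replace (A / B * B) with A by (field; lra). lra. }
      rewrite pow1 in *. lra. }
  destruct (unit_cis z hz) as [s [hs e]]. exists s; split; [exact hs | rewrite e; reflexivity].
Qed.

Lemma Cmod_cis_minus x y : Cmod (cis x - cis y)%C = 2 * Rabs (sin ((x - y) / 2)).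
Proof.
  unfold Cmod, cis; simpl.
  replace ((cos x + - cos y) * ((cos x + - cos y) * 1) + (sin x + - sin y) * ((sin x + - sin y) * 1))
    with ((2 * sin ((x - y) / 2)) ^ 2).
  - rewrite <- Rsqr_pow2, sqrt_Rsqr_abs, Rabs_mult, (Rabs_pos_eq 2) by lra. reflexivity.
  - generalize (cos_half (x - y)) (sin2_cos2_pow ((x - y) / 2))
      (sin2_cos2_pow x) (sin2_cos2_pow y). rewrite cos_minus. intros. nra.
Qed.

(** Only |mu| matters, so it suffices to compare chord lengths along the circle: a chord is twice
    the sine of half the angle, and the ratio of image chord to chord tends both to |mu| and to d
    phase'(s). *)
Lemma multiplier_unit b d th s mu : 1 < b -> fk b d (cis th) (Fin (cis (- s))) = Fin (cis (- s)) ->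
  multiplier (fk b d (cis th)) (Fin (cis (- s))) mu -> Cmod mu = 1 ->
  INR d * dphase b s = 1.
Proof.
  intros hb hfix hm hmu.
  set (D := INR d * dphase b s).
  apply cond_eq; intros eps heps.
  (* Three errors of at most [e] separate D/2 from 1/2, hence at most 6 e separates D from 1. The
     bound 1/2 keeps |sin(h/2)|/h at most 1. *)
  set (e := Rmin (1 / 2) (eps / 8)).
  assert (he : 0 < e) by (apply Rmin_pos; lra).
  assert (he1 : e <= 1 / 2) by apply Rmin_l. assert (he2 : e <= eps / 8) by apply Rmin_r.
  unfold multiplier in hm. destruct hm as [_ hm].
  destruct (hm (cis (- s)) (fun P h => h) (mkposreal e he)) as [[d3 hd3] hdom].
  assert (H3 : forall w, Cmod (w - cis (- s))%C < d3 ->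
    Cmod ((fin_part (fk b d (cis th) (Fin w)) - fin_part (fk b d (cis th) (Fin (cis (- s)))))
            - (w - cis (- s)) * mu)%C <= e * Cmod (w - cis (- s))%C)
    by exact hdom.
  clear hm hdom.
  assert (hG : is_derive (fun t => sin ((INR d * phase b t - INR d * phase b s) / 2)) s (D / 2)).
  { evar_last.
    - apply (is_derive_comp sin (fun t => (INR d * phase b t - INR d * phase b s) / 2)).
      + apply is_derive_Reals, derivable_pt_lim_sin.
      + apply (is_derive_ext (fun t => / 2 * (INR d * phase b t - INR d * phase b s))).
        { intros t; unfold Rdiv; apply Rmult_comm. }
        apply is_derive_scal. apply @is_derive_minus; [|apply is_derive_const].
        apply is_derive_scal. apply is_derive_phase; lra.
    - simpl. unfold scal, minus, plus, opp, zero; simpl. unfold mult; simpl.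
      replace ((INR d * phase b s - INR d * phase b s) / 2) with 0 by field.
      rewrite cos_0. unfold D. field. }
  assert (hS : is_derive (fun t => sin ((t - s) / 2)) s (1 / 2)).
  { auto_derive; [exact I|]. replace ((s + - s) * / 2) with 0 by field. rewrite cos_0; field. }
  apply is_derive_Reals in hG. apply is_derive_Reals in hS.
  destruct (hG e he) as [[d1 hd1] H1]. destruct (hS e he) as [[d2 hd2] H2].
  simpl in H1, H2.
  set (h := Rmin (Rmin (d1 / 2) (d2 / 2)) (d3 / 2)).
  assert (hh : 0 < h) by (repeat apply Rmin_pos; lra).
  assert (hh1 : h < d1) by (unfold h; generalize (Rmin_l (Rmin (d1 / 2) (d2 / 2)) (d3 / 2)) (Rmin_l (d1 / 2) (d2 / 2)); lra).
  assert (hh2 : h < d2) by (unfold h; generalize (Rmin_l (Rmin (d1 / 2) (d2 / 2)) (d3 / 2)) (Rmin_r (d1 / 2) (d2 / 2)); lra).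
  assert (hh3 : h < d3) by (unfold h; generalize (Rmin_r (Rmin (d1 / 2) (d2 / 2)) (d3 / 2)); lra).
  specialize (H1 h ltac:(lra) ltac:(rewrite Rabs_pos_eq; lra)).
  specialize (H2 h ltac:(lra) ltac:(rewrite Rabs_pos_eq; lra)).
  replace ((INR d * phase b s - INR d * phase b s) / 2) with 0 in H1 by field.
  replace ((s - s) / 2) with 0 in H2 by field.
  replace (s + h - s) with h in H2 by ring.
  rewrite sin_0, Rminus_0_r in H1, H2.
  specialize (H3 (cis (- (s + h)))).
  rewrite !fk_cis in H3 by lra. simpl fin_part in H3.
  set (A := (cis (- (- th - INR d * phase b (s + h))) - cis (- (- th - INR d * phase b s)))%C) in *.
  set (B := (cis (- (s + h)) - cis (- s))%C) in *.
  assert (hA : Cmod A = 2 * Rabs (sin ((INR d * phase b (s + h) - INR d * phase b s) / 2))).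
  { unfold A; rewrite Cmod_cis_minus. do 3 f_equal. field. }
  assert (hB : Cmod B = 2 * Rabs (sin (h / 2))).
  { unfold B; rewrite Cmod_cis_minus. rewrite <- Rabs_Ropp, <- sin_neg. do 3 f_equal. field. }
  set (g := sin ((INR d * phase b (s + h) - INR d * phase b s) / 2)) in *.
  set (sg := sin (h / 2)) in *.
  assert (hsg : Rabs sg / h < 1 / 2 + e).
  { replace (Rabs sg / h) with (Rabs (sg / h)) by (rewrite Rabs_div, (Rabs_pos_eq h); lra).
    generalize (Rabs_triang_inv2 (sg / h) (1 / 2)); rewrite (Rabs_pos_eq (1 / 2)) by lra.
    intros k; generalize (Rle_abs (Rabs (sg / h) - 1 / 2)); lra. }
  assert (hlt : Cmod B < d3).
  { rewrite hB. assert (Rabs sg < (1 / 2 + e) * h).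
    { apply Rmult_lt_compat_r with (r := h) in hsg; [|lra].
      replace (Rabs sg / h * h) with (Rabs sg) in hsg by (field; lra). lra. }
    assert ((1 / 2 + e) * h <= 1 * h) by (apply Rmult_le_compat_r; lra).
    assert (h <= d3 / 2) by apply Rmin_r. lra. }
  specialize (H3 hlt).
  assert (hAB : Rabs (Cmod A - Cmod B) <= e * Cmod B).
  { apply Rle_trans with (2 := H3).
    assert (k1 := Cmod_triangle (A - B * mu)%C (B * mu)%C).
    assert (k2 := Cmod_triangle (A - (A - B * mu))%C (A - B * mu)%C).
    assert (k3 := Cmod_triangle A (- (A - B * mu))%C).
    replace (A - B * mu + B * mu)%C with A in k1 by ring.
    replace (A + - (A - B * mu))%C with (B * mu)%C in k3 by ring.
    rewrite Cmod_opp in k3. rewrite Cmod_mult, hmu, Rmult_1_r in k1, k3.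
    apply Rabs_le; lra. }
  assert (hgs : Rabs (Rabs (g / h) - Rabs (sg / h)) <= e * Rabs (sg / h)).
  { rewrite hA, hB in hAB. rewrite !Rabs_div, (Rabs_pos_eq h) by lra.
    replace (Rabs g / h - Rabs sg / h) with ((2 * Rabs g - 2 * Rabs sg) * / (2 * h)) by (field; lra).
    rewrite Rabs_mult, (Rabs_pos_eq (/ (2 * h))) by (left; apply Rinv_0_lt_compat; lra).
    replace (e * (Rabs sg / h)) with (e * (2 * Rabs sg) * / (2 * h)) by (field; lra).
    apply Rmult_le_compat_r; [left; apply Rinv_0_lt_compat; lra | exact hAB]. }
  assert (hD : 0 <= D / 2).
  { unfold D. generalize (dphase_pos b s hb) (pos_INR d); nra. }
  assert (k1 := Rabs_triang_inv2 (g / h) (D / 2)).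
  assert (k2 := Rabs_triang_inv2 (sg / h) (1 / 2)).
  rewrite (Rabs_pos_eq (D / 2)) in k1 by lra. rewrite (Rabs_pos_eq (1 / 2)) in k2 by lra.
  assert (k1' := Rle_lt_trans _ _ _ k1 H1). assert (k2' := Rle_lt_trans _ _ _ k2 H2).
  apply Rabs_lt_between in k1'. apply Rabs_lt_between in k2'. apply Rabs_le_between in hgs.
  assert (e * Rabs (sg / h) <= e) by nra.
  apply Rabs_def1; lra.
Qed.

(** A root of unity has modulus 1, so the parabolic point is a point of the circle where d phase' =
    1. If its coordinate is -t with t > 0, the fixed point equation reads t1 = t + d phase(t) and
    [neutral_param_ge] applies. *)
Lemma is_lambda1_spec b d l t0 : admissible b d -> theta0_spec b d t0 -> is_lambda1 b d l ->
  exists t1, l = cis t1 /\ t0 <= t1 < PI.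
Proof.
  intros hp h0 (t1 & hl & ht1 & p & hfix & mu & m & hmul & hm & hpow).
  destruct (hp) as [hd2 hb hbd]. assert (hd := admissible_INR b d hp).
  exists t1; split; [exact hl|]. split; [|lra].
  subst l. destruct (fk_fixed_unit b d t1 p hp hfix) as [s [hs ->]].
  assert (hmu : Cmod mu = 1).
  { apply (f_equal Cmod) in hpow. rewrite Cmod_pow, Cmod_1 in hpow.
    assert (h := Cmod_ge_0 mu).
    destruct (Rtotal_order (Cmod mu) 1) as [hlt | [e | hgt]]; [exfalso | exact e | exfalso].
    - assert (k := pow_lt_1_compat (Cmod mu) m (conj h hlt) ltac:(lia)). lra.
    - assert (k := Rlt_pow_R1 (Cmod mu) m hgt ltac:(lia)). lra. }
  assert (hD := multiplier_unit b d t1 s mu hb hfix hmul hmu).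
  rewrite fk_cis in hfix by lra. injection hfix as h1 h2.
  destruct (cis_inj (- (- t1 - INR d * phase b s)) (- s)) as [j hj].
  { unfold cis; rewrite h1, h2; reflexivity. }
  (* The slopes at 0 and at pi lie on opposite sides of 1, so the neutral coordinate is neither 0
     nor an endpoint. *)
  assert (hD0 : INR d * dphase b 0 < 1).
  { unfold dphase, den2; rewrite cos_0. apply Rmult_lt_reg_r with ((b + 1) ^ 2); [nra|].
    replace (INR d * ((b ^ 2 - 1) / (b ^ 2 + 1 + 2 * b * 1)) * (b + 1) ^ 2)
      with (INR d * (b - 1) * (b + 1)) by (field; nra). nra. }
  assert (hDpi : 1 < INR d * dphase b PI).
  { unfold dphase, den2; rewrite cos_PI. apply Rmult_lt_reg_r with ((b - 1) ^ 2); [nra|].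
    replace (INR d * ((b ^ 2 - 1) / (b ^ 2 + 1 + 2 * b * -1)) * (b - 1) ^ 2)
      with (INR d * (b + 1) * (b - 1)) by (field; nra).
    assert (b - 1 < INR d * (b + 1)) by nra. nra. }
  assert (hs0 : s <> 0) by (intros ->; lra).
  assert (hs1 : s <> PI) by (intros ->; lra).
  assert (hs2 : s <> - PI) by (intros ->; rewrite dphase_opp in hD; lra).
  assert (hpi := PI_RGT_0).
  destruct (Rtotal_order s 0) as [hlt | [e | hgt]]; [ | contradiction | ].
  - assert (ht : 0 < - s < PI) by lra.
    rewrite <- dphase_opp in hD.
    assert (hge := neutral_param_ge b d t0 (- s) hp h0 ht hD).
    destruct (phase_at_neutral b d (- s) hp ht hD) as [hle hpi'].
    assert (0 < phase b (- s)) by (rewrite <- (phase_0 b); apply phase_incr; lra).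
    rewrite phase_opp in *.
    assert (j = 0)%Z.
    { assert (IZR j < 1) by nra. assert (-1 < IZR j) by nra.
      assert (j < 1)%Z by (apply lt_IZR; lra). assert (-1 < j)%Z by (apply lt_IZR; lra). lia. }
    subst j. lra.
  (* On this side t1 + s + d phase(s) would be a multiple of 2 pi strictly between 0 and 2 pi. *)
  - assert (ht : 0 < s < PI) by lra.
    destruct (phase_at_neutral b d s hp ht hD) as [hle hpi'].
    assert (0 < phase b s) by (rewrite <- (phase_0 b); apply phase_incr; lra).
    exfalso.
    assert (0 < IZR j) by nra. assert (IZR j < 1) by nra.
    assert (j < 1)%Z by (apply lt_IZR; lra). assert (0 < j)%Z by (apply lt_IZR; lra). lia.
Qed.

(** * Expansion estimates *)

(* f_k in the coordinate s, z = exp(-i s). *)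
Definition lift (b th : R) (k : nat) (s : R) : R := - th - INR k * phase b s.

Lemma sin_ge_near x y : 0 <= x -> x <= y <= PI - x -> sin x <= sin y.
Proof.
  intros hx hy. destruct (Rle_dec y (PI / 2)) as [h|h].
  - apply sin_incr_1; lra.
  - rewrite <- (sin_PI_x y). apply sin_incr_1; lra.
Qed.

(** The first slope is read off the image angle and the second off half the new coordinate, which is
    -(theta/2 + k u); the factors b^2 - 1 cancel. *)
Lemma dphase_dphase_lift b th k s : 1 < b ->
  dphase b s * dphase b (lift b th k s) =
  ((b - 1) ^ 2 + 4 * b * sin (phase b s / 2) ^ 2) /
  ((b + 1) ^ 2 - 4 * b * sin (th / 2 + INR k * (phase b s / 2)) ^ 2).
Proof.
  intros hb. rewrite dphase_half_phase by lra. unfold dphase.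
  assert (hP := den2_pos b (lift b th k s) hb). rewrite den2_half_sin in *.
  replace (lift b th k s / 2) with (- (th / 2 + INR k * (phase b s / 2))) in *
    by (unfold lift; field).
  rewrite sin_neg in *.
  replace ((- sin (th / 2 + INR k * (phase b s / 2))) ^ 2)
    with (sin (th / 2 + INR k * (phase b s / 2)) ^ 2) in * by ring.
  field. nra.
Qed.

Lemma phase_half_range b th s : 1 < b -> 0 <= s <= 2 * PI - th ->
  0 <= phase b s / 2 <= PI - phase b th / 2.
Proof.
  intros hb hs.
  assert (h1 := phase_incr_le b 0 s hb ltac:(lra)). rewrite phase_0 in h1.
  assert (h2 := phase_incr_le b s (- th + 2 * IZR 1 * PI) hb ltac:(simpl; lra)).
  rewrite phase_period, phase_opp in h2. lra.
Qed.

(** After the denominators are cleared, this is precisely the estimate needed for the product of two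
    slopes of f_d. For small d u the second sine suffices alone. *)
Lemma sin2_add_ge b d t0 th s : admissible b d -> theta0_spec b d t0 -> t0 <= th < PI ->
  0 <= s <= 2 * PI - th ->
  sin (t0 / 2) ^ 2 <=
  INR d ^ 2 * sin (phase b s / 2) ^ 2 + sin (th / 2 + INR d * (phase b s / 2)) ^ 2.
Proof.
  intros hp h0 hth hs. destruct (hp) as [hd2 hb _]. destruct (h0) as [hr he].
  assert (hd := admissible_INR b d hp).
  assert (hu := phase_half_range b th s hb hs). set (u := phase b s / 2) in *.
  assert (hs0 : 0 <= sin (t0 / 2)) by (apply sin_ge_0; lra).
  assert (hs1 := SIN_bound (t0 / 2)).
  assert (hpi := PI_RGT_0).
  assert (hx := pow2_ge_0 (sin (th / 2 + INR d * u))).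
  assert (hd0 : 0 < PI / 2 / INR d) by (apply Rdiv_lt_0_compat; lra).
  assert (hdd : INR d * (PI / 2 / INR d) = PI / 2) by (field; lra).
  destruct (Rle_dec (INR d * u) (PI - th)) as [c1 | c1].
  { assert (sin (t0 / 2) <= sin (th / 2 + INR d * u)) by (apply sin_ge_near; nra).
    assert (0 <= INR d ^ 2 * sin u ^ 2) by (apply Rmult_le_pos; apply pow2_ge_0). nra. }
  (* Here the terms dominate sin(d u)^2 and cos(d u)^2, so their sum is at least 1. *)
  destruct (Rle_dec (INR d * u) (PI / 2)) as [c2 | c2].
  { assert (h1 := sin_mult_sqr_le d u).
    assert (h2 : cos (INR d * u) <= cos (INR d * u - (PI - th) / 2))
      by (apply cos_decr_1; lra).
    assert (h3 : 0 <= cos (INR d * u)) by (apply cos_ge_0; nra).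
    replace (th / 2 + INR d * u) with (PI / 2 + (INR d * u - (PI - th) / 2)) by field.
    rewrite sin_plus, sin_PI2, cos_PI2.
    generalize (sin2_cos2_pow (INR d * u)). nra. }
  (* Here sin u >= sin(pi/(2d)) >= 1/d, and the first term alone is at least 1. *)
  destruct (Rle_dec u (PI - PI / 2 / INR d)) as [c3 | c3].
  { assert (h1 := sin_div_le d (PI / 2) ltac:(lia)). rewrite sin_PI2 in h1.
    assert (h2 : sin (PI / 2 / INR d) <= sin u) by (apply sin_ge_near; nra).
    assert (h3 : 0 <= sin (PI / 2 / INR d)).
    { apply sin_ge_0; [lra|]. nra. }
    assert (sin (PI / 2 / INR d) ^ 2 <= sin u ^ 2) by nra.
    assert (0 <= INR d ^ 2) by nra. nra. }
  (* Near the other end, pi - u is still at least phase(t0)/2 = t0/(2d), so the first term alone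
     suffices again. *)
  assert (h1 := sin_div_le d (t0 / 2) ltac:(lia)).
  replace (t0 / 2 / INR d) with (phase b t0 / 2) in h1 by (rewrite he at 2; field; lra).
  assert (hph : 0 < phase b t0) by nra.
  assert (hph' := phase_incr_le b t0 th hb ltac:(lra)).
  assert (PI / 2 / INR d <= PI / 2) by nra.
  assert (h2 : sin (phase b t0 / 2) <= sin u).
  { rewrite <- (sin_PI_x u). apply sin_incr_1; lra. }
  assert (h3 : 0 <= sin (phase b t0 / 2)) by (apply sin_ge_0; lra).
  assert (sin (phase b t0 / 2) ^ 2 <= sin u ^ 2) by nra.
  assert (0 <= INR d ^ 2) by nra. nra.
Qed.

(** The excess over 1 is the repulsion margin of the cycle through 1 and lambda0, divided by the
    largest possible denominator; it does not depend on s. *)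
Lemma two_step_expansion b d t0 th s : admissible b d -> theta0_spec b d t0 -> t0 <= th < PI ->
  0 <= s <= 2 * PI - th ->
  1 + (INR d ^ 2 * (b - 1) ^ 2 - den2 b t0) / (b + 1) ^ 2 <=
  INR d ^ 2 * (dphase b s * dphase b (lift b th d s)).
Proof.
  intros hp h0 hth hs. destruct (hp) as [hd2 hb _].
  assert (h := sin2_add_ge b d t0 th s hp h0 hth hs).
  rewrite dphase_dphase_lift by lra.
  set (X := sin (phase b s / 2) ^ 2) in *.
  assert (hP := den2_half_sin b t0).
  assert (hb1 : sin (th / 2 + INR d * (phase b s / 2)) ^ 2 <= 1).
  { generalize (sin2_cos2_pow (th / 2 + INR d * (phase b s / 2))); nra. }
  assert (hb0 := pow2_ge_0 (sin (th / 2 + INR d * (phase b s / 2)))).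
  set (Y := sin (th / 2 + INR d * (phase b s / 2)) ^ 2) in *.
  assert (hrep := theta0_repelling b d t0 hp h0).
  set (e := INR d ^ 2 * (b - 1) ^ 2 - den2 b t0) in *.
  assert (he : 0 < e) by (unfold e; lra).
  assert (hden : 0 < (b + 1) ^ 2 - 4 * b * Y) by nra.
  replace (INR d ^ 2 * (((b - 1) ^ 2 + 4 * b * X) / ((b + 1) ^ 2 - 4 * b * Y)))
    with (INR d ^ 2 * ((b - 1) ^ 2 + 4 * b * X) / ((b + 1) ^ 2 - 4 * b * Y)) by (field; lra).
  apply Rle_div_r; [lra|].
  assert (e / (b + 1) ^ 2 * ((b + 1) ^ 2 - 4 * b * Y) <= e).
  { replace e with (e / (b + 1) ^ 2 * (b + 1) ^ 2) at 2 by (field; nra).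
    apply Rmult_le_compat_l; [|nra].
    left; apply Rdiv_lt_0_compat; nra. }
  assert (4 * b * sin (t0 / 2) ^ 2 <= 4 * b * (INR d ^ 2 * X + Y))
    by (apply Rmult_le_compat_l; lra).
  unfold e in *. nra.
Qed.

Lemma first_multiple u B n : 0 < u -> 0 < B <= INR n * u ->
  exists k, (1 <= k <= n)%nat /\ (INR k - 1) * u < B <= INR k * u.
Proof.
  intros hu. induction n as [|n IH]; intros hB.
  - simpl in hB; lra.
  - destruct (Rle_dec B (INR n * u)) as [h|h].
    + destruct (IH ltac:(lra)) as [k [hk1 hk2]]. exists k; split; [lia | lra].
    + exists (S n); split; [lia|]. rewrite S_INR in *. lra.
Qed.

Lemma last_multiple u B n : 0 < u <= B -> B < INR n * u ->
  exists k, (1 <= k < n)%nat /\ INR k * u <= B < (INR k + 1) * u.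
Proof.
  intros hu. induction n as [|n IH]; intros hB.
  - simpl in hB; lra.
  - rewrite S_INR in hB. destruct (Rlt_dec B (INR n * u)) as [h|h].
    + destruct (IH h) as [k [hk1 hk2]]. exists k; split; [lia | lra].
    + exists n. split; [|lra]. destruct n; [simpl in hB; lra | lia].
Qed.

Lemma sin2_sub_sin2 x y : sin x ^ 2 - sin y ^ 2 = sin (x + y) * sin (x - y).
Proof.
  rewrite sin_plus, sin_minus.
  generalize (sin2_cos2_pow x) (sin2_cos2_pow y). intros hx hy.
  transitivity (sin x ^ 2 * cos y ^ 2 - cos x ^ 2 * sin y ^ 2); [|ring].
  replace (cos y ^ 2) with (1 - sin y ^ 2) by lra.
  replace (cos x ^ 2) with (1 - sin x ^ 2) by lra. ring.
Qed.

(* u = phase s / 2.  With k u = (pi - theta)/2 + x mod pi, the point f_k(s) has coordinate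
   pi - 2 x; the slack in the lower bound on x keeps the estimate uniform where only k = 1
   would give x >= 0, with an expansion factor tending to 1. *)
Lemma gap_step b d th : admissible b d -> 0 < th < PI ->
  exists e2, 0 < e2 /\
  forall u, (PI - th / 2) / INR d <= u <= PI - PI / INR d ->
  exists (k : nat) (x : R) (j : Z),
    (1 <= k < d)%nat /\ INR k * u = (PI - th) / 2 + x + IZR j * PI /\
    - ((PI - th) / 4 * ((b - 1) / (b + 1))) <= x <= PI / 2 /\
    e2 <= INR k * sin u ^ 2 - sin x ^ 2.
Proof.
  intros hp hth. destruct (hp) as [hd2 hb hbd]. assert (hd := admissible_INR b d hp).
  (* The slack [ep] allows f_k(s) to pass pi by 2 ep = de (b-1)/(b+1); since phase has slope at most
     (b+1)/(b-1), the phase then passes pi by at most [de]. *)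
  set (de := (PI - th) / 2). set (ep := (PI - th) / 4 * ((b - 1) / (b + 1))).
  assert (hde : 0 < de < PI / 2) by (unfold de; lra).
  assert (hka : 0 < (b - 1) / (b + 1) < 1 / INR d).
  { split; [apply Rdiv_lt_0_compat; lra|].
    apply Rmult_lt_reg_r with (INR d * (b + 1)); [nra|].
    replace ((b - 1) / (b + 1) * (INR d * (b + 1))) with (INR d * (b - 1)) by (field; lra).
    replace (1 / INR d * (INR d * (b + 1))) with (b + 1) by (field; lra). lra. }
  assert (hd1 : 0 < / INR d <= / 2).
  { split; [apply Rinv_0_lt_compat; lra | apply Rinv_le_contravar; lra]. }
  replace (1 / INR d) with (/ INR d) in hka by (field; lra).
  assert (hep : 0 < ep < de).
  { unfold ep, de; split; nra. }
  assert (hepd : ep <= PI / INR d).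
  { unfold Rdiv at 1. unfold ep. nra. }
  assert (hpd : 0 < PI / INR d <= PI / 2) by (unfold Rdiv; nra).
  assert (s1 : 0 < sin de) by (apply sin_gt_0; lra).
  assert (s2 : 0 < sin ep) by (apply sin_gt_0; lra).
  assert (s3 : 0 < sin (PI / INR d / 2)) by (apply sin_gt_0; lra).
  assert (s4 : sin (PI / INR d / 2) <= sin (PI / INR d)) by (apply sin_incr_1; lra).
  assert (s5 : sin ep <= sin de) by (apply sin_incr_1; lra).
  (* The first bound serves k = 1, where the difference of squares factors into two sines; the
     second serves k >= 2, where one spare copy of sin(u)^2 remains. *)
  exists (Rmin (sin ep * sin de) (sin (PI / INR d / 2) ^ 2)). split.
  { apply Rmin_pos; nra. }
  assert (m1 := Rmin_l (sin ep * sin de) (sin (PI / INR d / 2) ^ 2)).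
  assert (m2 := Rmin_r (sin ep * sin de) (sin (PI / INR d / 2) ^ 2)).
  set (e2 := Rmin (sin ep * sin de) (sin (PI / INR d / 2) ^ 2)) in *.
  intros u hu.
  assert (hu0 : PI / INR d / 2 <= u).
  { apply Rle_trans with (2 := proj1 hu). unfold Rdiv. nra. }
  (* For u < de the first multiple of u reaching [de] has k >= 2 and overshoots by less than u. *)
  destruct (Rlt_dec u de) as [c1 | c1].
  - assert (hn : INR (d - 1) = INR d - 1) by (rewrite minus_INR by lia; simpl; ring).
    destruct (first_multiple u de (d - 1)) as [k [hk1 hk2]]; [lra | | ].
    { split; [lra|]. rewrite hn.
      apply Rle_trans with ((INR d - 1) * ((PI - th / 2) / INR d)); [|apply Rmult_le_compat_l; lra].
      replace ((INR d - 1) * ((PI - th / 2) / INR d)) with ((1 - / INR d) * (PI - th / 2)) by (field; lra).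
      unfold de. nra. }
    assert (hk3 : (2 <= k)%nat).
    { destruct k as [|[|k]]; [lia | simpl in hk2; lra | lia]. }
    assert (hk4 : 2 <= INR k) by (apply (le_INR 2); lia).
    exists k, (INR k * u - de), 0%Z. repeat split; try lia; try lra.
    assert (0 <= sin (INR k * u - de) <= sin u).
    { split; [apply sin_ge_0; lra | apply sin_incr_1; lra]. }
    assert (sin (PI / INR d / 2) <= sin u) by (apply sin_incr_1; lra).
    assert (sin (INR k * u - de) ^ 2 <= sin u ^ 2) by nra.
    assert (sin (PI / INR d / 2) ^ 2 <= sin u ^ 2) by nra.
    nra.
  - destruct (Rle_dec u (PI / 2)) as [c2 | c2].
    + exists 1%nat, (u - de), 0%Z. simpl INR. repeat split; try lia; try lra.
      rewrite Rmult_1_l, sin2_sub_sin2.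
        replace (u - (u - de)) with de by ring.
        assert (sin de <= sin (u + (u - de))) by (apply sin_ge_near; lra).
        nra.
    (* For u past pi/2 the multiples of u move backwards by a = pi - u modulo pi, so the last
       multiple of [a] before the target is taken; d a >= pi keeps k below d. *)
    + set (a := PI - u). assert (ha : PI / INR d <= a < PI / 2) by (unfold a; lra).
      assert (had : PI <= INR d * a).
      { replace PI with (INR d * (PI / INR d)) at 1 by (field; lra).
        apply Rmult_le_compat_l; lra. }
      destruct (last_multiple a (PI - de + ep) d) as [k [hk1 hk2]]; [lra | lra |].
      assert (hk4 : 1 <= INR k) by (apply (le_INR 1); lia).
      assert (hsu : sin u = sin a) by (unfold a; rewrite sin_PI_x; reflexivity).
      exists k, (PI - de - INR k * a), (Z.of_nat k - 1)%Z.
      rewrite hsu, minus_IZR, <- INR_IZR_INZ.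
      repeat split; try lia; try nra.
      * unfold a. ring.
      * destruct (Nat.eq_dec k 1) as [->|hk].
        { simpl INR in *. rewrite Rmult_1_l, sin2_sub_sin2.
          replace (a + (PI - de - 1 * a)) with (PI - de) by ring.
          rewrite sin_PI_x.
          assert (sin ep <= sin (a - (PI - de - 1 * a))) by (apply sin_ge_near; lra).
          nra. }
        { assert (2 <= INR k) by (apply (le_INR 2); lia).
          assert (- sin a <= sin (PI - de - INR k * a) <= sin a).
          { rewrite <- sin_neg. split; apply sin_incr_1; lra. }
          assert (sin (PI / INR d) <= sin a) by (apply sin_incr_1; lra).
          nra. }
Qed.

(** * The choice of one expanding step inside the arc *)

Definition in_arc (th s : R) : Prop :=
  exists j : Z, 0 <= s + 2 * IZR j * PI <= 2 * PI - th.

Definition step (b th : R) (d k : nat) (s : R) : R :=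
  if Nat.eqb k d then lift b th d s else lift b th 1 (lift b th k s).

(** The absolute value of the derivative of [step], by the chain rule. *)
Definition step_speed (b th : R) (d k : nat) (s : R) : R :=
  if Nat.eqb k d then INR d * dphase b s
  else INR k * dphase b s * dphase b (lift b th k s).

(* Density of the expanded metric; q is the expansion factor. *)
Definition weight (b q : R) (d : nat) (s : R) : R := Rmin 1 (INR d * dphase b s / q).

Lemma lift_period b th k s j :
  lift b th k (s + 2 * IZR j * PI) = lift b th k s + 2 * IZR (- Z.of_nat k * j) * PI.
Proof.
  unfold lift. rewrite phase_period, mult_IZR, opp_IZR, <- INR_IZR_INZ. ring.
Qed.

Lemma in_arc_period th s j : in_arc th (s + 2 * IZR j * PI) <-> in_arc th s.
Proof.
  split; intros [i hi].
  - exists (j + i)%Z. rewrite plus_IZR. lra.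
  - exists (i - j)%Z. rewrite minus_IZR. lra.
Qed.

Lemma sin2_shift x j : sin (x + IZR j * PI) ^ 2 = sin x ^ 2.
Proof.
  assert (h : forall y, sin y ^ 2 = (1 - cos (2 * y)) / 2).
  { intros y. rewrite cos_2a_sin. field. }
  rewrite !h. replace (2 * (x + IZR j * PI)) with (2 * x + 2 * IZR j * PI) by ring.
  rewrite cos_period_Z. reflexivity.
Qed.

(** Modulo 2 pi, f_d(s) is -theta - 2 d u, so it misses the arc only if d u modulo pi exceeds pi -
    theta/2. The integer part m of d u / pi then gives both bounds on u. *)
Lemma gap_range b d t0 th s : admissible b d -> theta0_spec b d t0 -> t0 <= th < PI ->
  0 <= s <= 2 * PI - th ->
  in_arc th (lift b th d s) \/
  (PI - th / 2) / INR d <= phase b s / 2 <= PI - PI / INR d.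
Proof.
  intros hp h0 hth hs. destruct (hp) as [hd2 hb hbd]. assert (hd := admissible_INR b d hp).
  assert (hpi := PI_RGT_0).
  assert (hu := phase_half_range b th s hb hs). set (u := phase b s / 2) in *.
  assert (habove := phase_above b d t0 th hp h0 ltac:(lra)).
  destruct (floor_ex (INR d * u / PI)) as [m hm].
  assert (hm' : IZR m * PI <= INR d * u < (IZR m + 1) * PI).
  { replace (INR d * u) with (INR d * u / PI * PI) by (field; lra).
    split; [apply Rmult_le_compat_r | apply Rmult_lt_compat_r]; lra. }
  destruct (Rle_dec (INR d * u - IZR m * PI) (PI - th / 2)) as [c|c].
  - left. exists (m + 1)%Z. rewrite plus_IZR.
    replace (lift b th d s) with (- th - 2 * (INR d * u)) by (unfold lift, u; field).
    simpl IZR. lra.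
  - right. destruct (h0) as [hr _].
    assert (hdu : 0 <= INR d * u) by (apply Rmult_le_pos; lra).
    assert (hdu2 : INR d * u <= INR d * PI - th / 2).
    { apply Rle_trans with (INR d * (PI - phase b th / 2)); [apply Rmult_le_compat_l; lra | lra]. }
    assert (hm0 : (0 <= m)%Z).
    { assert (-1 < m)%Z; [|lia]. apply lt_IZR. simpl. nra. }
    assert (hm1 : (m <= Z.of_nat d - 2)%Z).
    { assert (hlt : (m < Z.of_nat d)%Z).
      { apply lt_IZR. rewrite <- INR_IZR_INZ. nra. }
      (* The last value of m is excluded by d phase(theta) >= theta, that is, by theta >= theta0. *)
      assert (hne : (m <> Z.of_nat d - 1)%Z); [|lia].
      intros ->. rewrite minus_IZR, <- INR_IZR_INZ in c. simpl in c. lra. }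
    apply IZR_le in hm0. apply IZR_le in hm1.
    rewrite minus_IZR, <- INR_IZR_INZ in hm1. simpl in hm0, hm1.
    split.
    + apply Rmult_le_reg_l with (INR d); [lra|].
      replace (INR d * ((PI - th / 2) / INR d)) with (PI - th / 2) by (field; lra). nra.
    + apply Rmult_le_reg_l with (INR d); [lra|].
      replace (INR d * (PI - PI / INR d)) with ((INR d - 1) * PI) by (field; lra). nra.
Qed.

(** On this range sin(u)^2 >= 1/d^2, which follows from 1 = sin(pi/2) <= d sin(pi/(2d)). *)
Lemma gap_dphase b d u : admissible b d -> 
  PI / 2 / INR d <= u <= PI - PI / 2 / INR d ->
  (INR d ^ 2 * (b - 1) ^ 2 + 4 * b) / (INR d * (b ^ 2 - 1)) <=
  INR d * (((b - 1) ^ 2 + 4 * b * sin u ^ 2) / (b ^ 2 - 1)).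
Proof.
  intros hp hu. destruct (hp) as [hd2 hb hbd]. assert (hd := admissible_INR b d hp).
  assert (hpi := PI_RGT_0).
  assert (h1 := sin_div_le d (PI / 2) ltac:(lia)). rewrite sin_PI2 in h1.
  assert (hd0 : 0 < PI / 2 / INR d) by (apply Rdiv_lt_0_compat; lra).
  assert (h2 : sin (PI / 2 / INR d) <= sin u) by (apply sin_ge_near; lra).
  assert (h3 : 0 <= sin (PI / 2 / INR d)) by (apply sin_ge_0; lra).
  assert (h4 : sin (PI / 2 / INR d) ^ 2 <= sin u ^ 2) by nra.
  assert (h5 : 1 <= INR d ^ 2 * sin u ^ 2).
  { assert (0 <= INR d ^ 2) by nra. nra. }
  assert (hb2 : 0 < b ^ 2 - 1) by nra.
  apply Rmult_le_reg_r with (INR d * (b ^ 2 - 1)); [nra|].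
  replace ((INR d ^ 2 * (b - 1) ^ 2 + 4 * b) / (INR d * (b ^ 2 - 1)) * (INR d * (b ^ 2 - 1)))
    with (INR d ^ 2 * (b - 1) ^ 2 + 4 * b) by (field; lra).
  replace (INR d * (((b - 1) ^ 2 + 4 * b * sin u ^ 2) / (b ^ 2 - 1)) * (INR d * (b ^ 2 - 1)))
    with (INR d ^ 2 * (b - 1) ^ 2 + 4 * b * (INR d ^ 2 * sin u ^ 2)) by (field; lra).
  nra.
Qed.

(** Numerator minus denominator is (d^2-1)(b-1)^2 + (b+1)(b+1-d(b-1)), a sum of two positive
    terms. *)
Lemma gap_dphase_gt_1 b d : admissible b d ->
  1 < (INR d ^ 2 * (b - 1) ^ 2 + 4 * b) / (INR d * (b ^ 2 - 1)).
Proof.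
  intros hp. destruct (hp) as [hd2 hb hbd]. assert (hd := admissible_INR b d hp).
  assert (hb2 : 0 < b ^ 2 - 1) by nra.
  apply Rmult_lt_reg_r with (INR d * (b ^ 2 - 1)); [nra|].
  replace ((INR d ^ 2 * (b - 1) ^ 2 + 4 * b) / (INR d * (b ^ 2 - 1)) * (INR d * (b ^ 2 - 1)))
    with (INR d ^ 2 * (b - 1) ^ 2 + 4 * b) by (field; lra).
  assert (0 < (b + 1) * (b + 1 - INR d * (b - 1))) by (apply Rmult_lt_0_compat; lra).
  assert (0 < (b - 1) ^ 2) by nra. assert (1 < INR d ^ 2) by nra.
  assert ((b - 1) ^ 2 < INR d ^ 2 * (b - 1) ^ 2) by nra.
  nra.
Qed.

Lemma dphase_le_max b s : 1 < b -> dphase b s <= (b + 1) / (b - 1).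
Proof.
  intros hb. unfold dphase.
  replace ((b + 1) / (b - 1)) with ((b ^ 2 - 1) / (b - 1) ^ 2) by (field; lra).
  apply Rmult_le_compat_l; [nra|]. apply Rinv_le_contravar; [nra | apply den2_lower; lra].
Qed.

(** [E0], [E1] and [E2] bound from below the two-step expansion of f_d, the slope of f_d where its
    image misses the arc, and the Euclidean expansion of f_1 o f_k there. *)
Lemma expanding_step b d t0 th : admissible b d -> theta0_spec b d t0 -> t0 <= th < PI ->
  exists q, 1 < q /\ forall s, in_arc th s ->
  exists k, (1 <= k <= d)%nat /\ in_arc th (step b th d k s) /\
    q * weight b q d s <= weight b q d (step b th d k s) * step_speed b th d k s.
Proof.
  intros hp h0 hth. destruct (hp) as [hd2 hb hbd]. assert (hd := admissible_INR b d hp).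
  destruct (h0) as [hr _]. assert (hpi := PI_RGT_0).
  destruct (gap_step b d th hp ltac:(lra)) as [e2 [he2 hgap]].
  assert (hrep := theta0_repelling b d t0 hp h0).
  set (E0 := 1 + (INR d ^ 2 * (b - 1) ^ 2 - den2 b t0) / (b + 1) ^ 2).
  set (E1 := (INR d ^ 2 * (b - 1) ^ 2 + 4 * b) / (INR d * (b ^ 2 - 1))).
  set (E2 := 1 + 4 * b * e2 / (b + 1) ^ 2).
  assert (hE0 : 1 < E0).
  { unfold E0. assert (0 < (INR d ^ 2 * (b - 1) ^ 2 - den2 b t0) / (b + 1) ^ 2); [|lra].
    apply Rdiv_lt_0_compat; nra. }
  assert (hE1 : 1 < E1) by (apply gap_dphase_gt_1, hp).
  assert (hE2 : 1 < E2).
  { unfold E2. assert (0 < 4 * b * e2 / (b + 1) ^ 2); [|lra].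
    apply Rdiv_lt_0_compat; nra. }
  set (E := Rmin E0 (Rmin E1 E2)).
  assert (hE : 1 < E) by (repeat apply Rmin_glb_lt; lra).
  assert (hEE0 : E <= E0) by apply Rmin_l.
  assert (hEE1 : E <= E1) by (eapply Rle_trans; [apply Rmin_r | apply Rmin_l]).
  assert (hEE2 : E <= E2) by (eapply Rle_trans; [apply Rmin_r | apply Rmin_r]).
  clearbody E.
  (* The square root shares a two-step gain of at least E equally between two consecutive steps. *)
  set (q := sqrt E).
  assert (hqq : q * q = E) by (apply sqrt_sqrt; lra).
  assert (hq : 1 < q).
  { assert (0 <= q) by apply sqrt_pos. nra. }
  clearbody q. exists q; split; [exact hq|].
  assert (hw1 : forall s, weight b q d s <= 1) by (intros s; apply Rmin_l).
  assert (hw2 : forall s, q * weight b q d s <= INR d * dphase b s).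
  { intros s. apply Rle_trans with (q * (INR d * dphase b s / q)).
    - apply Rmult_le_compat_l; [lra | apply Rmin_r].
    - right; field; lra. }
  assert (main : forall s, 0 <= s <= 2 * PI - th ->
    exists k, (1 <= k <= d)%nat /\ in_arc th (step b th d k s) /\
    q * weight b q d s <= weight b q d (step b th d k s) * step_speed b th d k s).
  { intros s hs. assert (hDs := dphase_pos b s hb).
    destruct (gap_range b d t0 th s hp h0 hth hs) as [hin | hu].
    - exists d. unfold step, step_speed. rewrite Nat.eqb_refl.
      split; [lia|]. split; [exact hin|].
      assert (h := two_step_expansion b d t0 th s hp h0 hth hs). fold E0 in h.
      unfold weight at 2. rewrite Rmult_comm.
      rewrite Rmult_comm, <- (Rmult_comm (INR d * dphase b s)).
      assert (hD := dphase_pos b (lift b th d s) hb).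
      unfold Rmin at 1. destruct Rle_dec as [c|c].
      + rewrite Rmult_1_r. apply hw2.
      + apply Rle_trans with q; [generalize (hw1 s); nra|].
        apply Rmult_le_reg_r with q; [lra|].
        replace (INR d * dphase b s * (INR d * dphase b (lift b th d s) / q) * q)
          with (INR d ^ 2 * (dphase b s * dphase b (lift b th d s))) by (field; lra).
        lra.
    - destruct (hgap _ hu) as (k & x & j & hk & hkx & hx & hsin).
      assert (hk1 : 1 <= INR k) by (apply (le_INR 1); lia).
      set (u := phase b s / 2) in *. set (de := (PI - th) / 2) in *.
      assert (hkd : Nat.eqb k d = false) by (apply Nat.eqb_neq; lia).
      exists k. unfold step, step_speed. rewrite hkd. split; [lia|].
      set (s1 := PI - 2 * x).
      assert (hl1 : lift b th k s = s1 + 2 * IZR (-1 - j) * PI).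
      { unfold lift, s1. rewrite minus_IZR.
        replace (INR k * phase b s) with (2 * (INR k * u)) by (unfold u; field).
        rewrite hkx. unfold de. simpl IZR. field. }
      assert (hs1 : 0 <= s1 <= PI + de * ((b - 1) / (b + 1))) by (unfold s1, de; lra).
      assert (hph0 : 0 <= phase b s1) by (rewrite <- (phase_0 b); apply phase_incr_le; lra).
      assert (hde : 0 < de < PI / 2) by (unfold de; lra).
      (* The arc only requires pi + 2 de; the sharper bound makes sin(2 a1 - de) nonnegative
         below. *)
      assert (hph1 : phase b s1 <= PI + de).
      { destruct (Rle_dec s1 PI) as [c|c].
        - apply Rle_trans with PI; [|lra]. rewrite <- (phase_PI b). apply phase_incr_le; lra.
        - destruct (phase_mvt b PI s1 hb ltac:(lra)) as [z [hz e]].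
          rewrite phase_PI in e.
          assert (hz' := dphase_le_max b z hb). assert (hz0 := dphase_pos b z hb).
          assert (dphase b z * (s1 - PI) <= (b + 1) / (b - 1) * (de * ((b - 1) / (b + 1))))
            by (apply Rmult_le_compat; lra).
          replace ((b + 1) / (b - 1) * (de * ((b - 1) / (b + 1)))) with de in H by (field; lra).
          lra. }
      set (s2 := lift b th 1 s1).
      assert (hl2 : lift b th 1 (lift b th k s) = s2 + 2 * IZR (1 + j) * PI).
      { rewrite hl1, lift_period. do 4 f_equal. lia. }
      rewrite hl2. split.
      { exists (- j)%Z. rewrite plus_IZR, opp_IZR. unfold s2, lift. simpl.
        assert (th = PI - 2 * de) by (unfold de; lra). lra. }
      replace (weight b q d (s2 + 2 * IZR (1 + j) * PI)) with (weight b q d s2)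
        by (unfold weight; rewrite dphase_period; reflexivity).
      (* expansion of f_1 o f_k in the Euclidean metric *)
      assert (hF : q <= INR k * dphase b s * dphase b (lift b th k s)).
      { rewrite Rmult_assoc, dphase_dphase_lift by lra. fold u.
        replace (th / 2 + INR k * u) with (PI / 2 + x + IZR j * PI)
          by (rewrite hkx; unfold de; field).
        rewrite sin2_shift, sin_plus, sin_PI2, cos_PI2.
        replace ((1 * cos x + 0 * sin x) ^ 2) with (cos x ^ 2) by ring.
        replace (cos x ^ 2) with (1 - sin x ^ 2) by (generalize (sin2_cos2_pow x); lra).
        replace ((b + 1) ^ 2 - 4 * b * (1 - sin x ^ 2)) with ((b - 1) ^ 2 + 4 * b * sin x ^ 2) by ring.
        assert (hsx : 0 <= sin x ^ 2 <= 1).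
        { split; [apply pow2_ge_0|]. generalize (sin2_cos2_pow x); nra. }
        apply Rle_trans with E; [nra|]. apply Rle_trans with E2; [lra|].
        set (M := (b - 1) ^ 2 + 4 * b * sin x ^ 2).
        assert (hM : 0 < M <= (b + 1) ^ 2) by (unfold M; nra).
        apply Rmult_le_reg_r with M; [lra|].
        replace (INR k * (((b - 1) ^ 2 + 4 * b * sin u ^ 2) / M) * M)
          with (INR k * ((b - 1) ^ 2 + 4 * b * sin u ^ 2)) by (field; lra).
        assert (4 * b * e2 / (b + 1) ^ 2 * M <= 4 * b * e2).
        { apply Rle_trans with (4 * b * e2 / (b + 1) ^ 2 * (b + 1) ^ 2).
          - apply Rmult_le_compat_l; [|lra]. left; apply Rdiv_lt_0_compat; nra.
          - right; field; lra. }
        unfold E2.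
        assert (4 * b * e2 <= 4 * b * (INR k * sin u ^ 2 - sin x ^ 2))
          by (apply Rmult_le_compat_l; lra).
        assert (0 <= (INR k - 1) * (b - 1) ^ 2) by (apply Rmult_le_pos; [lra | apply pow2_ge_0]).
        assert (M <= INR k * ((b - 1) ^ 2 + 4 * b * sin u ^ 2) - 4 * b * e2) by (unfold M; lra).
        rewrite Rmult_plus_distr_r. lra. }
      set (F := INR k * dphase b s * dphase b (lift b th k s)) in *.
      (* If the weight at [s2] is 1, the Euclidean estimate suffices. Otherwise the small slope at
         [s2] is compensated by those at [s] and [s1]. *)
      destruct (Rle_dec q (INR d * dphase b s2)) as [c|c].
      { replace (weight b q d s2) with 1.
        - generalize (hw1 s); nra.
        - unfold weight. rewrite Rmin_left; [reflexivity|].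
          apply Rmult_le_reg_r with q; [lra|].
          replace (INR d * dphase b s2 / q * q) with (INR d * dphase b s2) by (field; lra). lra. }
      set (a1 := phase b s1 / 2).
      (* Otherwise [s2] is so close to lambda that its slope is at least the one at theta0, and d
         phase'(t0) >= E0 >= q contradicts [c]. *)
      assert (ha1 : de / 2 <= a1).
      { apply Rnot_lt_le; intros hlt. apply c.
        assert (hcos : cos s2 <= cos t0).
        { rewrite <- (cos_neg s2). unfold s2, lift. simpl INR.
          replace (- (- th - 1 * phase b s1)) with (th + 2 * a1) by (unfold a1; field).
          apply cos_decr_1; unfold a1, de in *; lra. }
        assert (hle := dphase_le_cos b t0 s2 hb hcos).
        apply Rle_trans with E; [nra|]. apply Rle_trans with E0; [lra|].
        apply Rle_trans with (INR d * dphase b t0); [|apply Rmult_le_compat_l; lra].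
        assert (hP := den2_pos b t0 hb). assert (hP' := den2_upper b t0 hb).
        unfold dphase. apply Rmult_le_reg_r with (den2 b t0); [lra|].
        replace (INR d * ((b ^ 2 - 1) / den2 b t0) * den2 b t0) with (INR d * (b ^ 2 - 1)) by (field; lra).
        apply Rle_trans with (INR d ^ 2 * (b - 1) ^ 2).
        - unfold E0.
          assert ((INR d ^ 2 * (b - 1) ^ 2 - den2 b t0) / (b + 1) ^ 2 * den2 b t0
                   <= INR d ^ 2 * (b - 1) ^ 2 - den2 b t0).
          { apply Rle_trans with ((INR d ^ 2 * (b - 1) ^ 2 - den2 b t0) / (b + 1) ^ 2 * (b + 1) ^ 2).
            - apply Rmult_le_compat_l; [|lra]. left; apply Rdiv_lt_0_compat; nra.
            - right; field; lra. }
          lra.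
        - replace (INR d ^ 2 * (b - 1) ^ 2) with (INR d * (b - 1) * (INR d * (b - 1))) by ring.
          replace (INR d * (b ^ 2 - 1)) with (INR d * (b - 1) * (b + 1)) by ring.
          apply Rmult_le_compat_l; nra. }
      (* The product is a quotient whose numerator and denominator differ by 4 b (sin(a1)^2 -
         sin(a1-de)^2), a positive multiple of sin(2 a1 - de) sin(de). *)
      assert (h12 : 1 <= dphase b s1 * dphase b s2).
      { unfold s2. rewrite dphase_dphase_lift by lra. fold a1. simpl INR.
        replace (th / 2 + 1 * a1) with (PI / 2 + (a1 - de)) by (unfold de; field).
        rewrite sin_plus, sin_PI2, cos_PI2.
        replace ((1 * cos (a1 - de) + 0 * sin (a1 - de)) ^ 2) with (1 - sin (a1 - de) ^ 2)
          by (generalize (sin2_cos2_pow (a1 - de)); lra).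
        assert (hdiff := sin2_sub_sin2 a1 (a1 - de)).
        replace (a1 - (a1 - de)) with de in hdiff by ring.
        assert (0 <= sin (a1 + (a1 - de))) by (apply sin_ge_0; unfold a1 in *; lra).
        assert (0 <= sin de) by (apply sin_ge_0; lra).
        assert (hsq := pow2_ge_0 (sin (a1 - de))).
        set (M := (b + 1) ^ 2 - 4 * b * (1 - sin (a1 - de) ^ 2)).
        assert (hM : 0 < M) by (unfold M; nra).
        apply Rmult_le_reg_r with M; [lra|].
        replace (((b - 1) ^ 2 + 4 * b * sin a1 ^ 2) / M * M)
          with ((b - 1) ^ 2 + 4 * b * sin a1 ^ 2) by (field; lra).
        unfold M. assert (0 <= sin (a1 + (a1 - de)) * sin de) by (apply Rmult_le_pos; lra).
        nra. }
      assert (hD : q * q <= INR d * dphase b s).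
      { rewrite hqq. apply Rle_trans with E1; [lra|].
        rewrite dphase_half_phase by lra. apply gap_dphase; [exact hp|]. fold u.
        assert (hi : 0 < / INR d) by (apply Rinv_0_lt_compat; lra).
        unfold Rdiv in *. split; [|nra].
        apply Rle_trans with (2 := proj1 hu). apply Rmult_le_compat_r; lra. }
      replace (weight b q d s2) with (INR d * dphase b s2 / q).
      + apply Rle_trans with q; [generalize (hw1 s); nra|].
        apply Rmult_le_reg_r with q; [lra|].
        replace (INR d * dphase b s2 / q * F * q)
          with (INR k * (INR d * dphase b s) * (dphase b s1 * dphase b s2)).
        * assert (0 < INR d * dphase b s) by nra.
          apply Rle_trans with (1 * (INR d * dphase b s) * 1); [lra|].
          apply Rmult_le_compat; [lra | lra | apply Rmult_le_compat_r; lra | lra].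
        * unfold F. rewrite hl1, dphase_period. field. lra.
      + unfold weight. rewrite Rmin_right; [reflexivity|].
        apply Rmult_le_reg_r with q; [lra|].
        replace (INR d * dphase b s2 / q * q) with (INR d * dphase b s2) by (field; lra). lra. }
  (* All quantities are 2 pi periodic up to a translation of the image, so the representative in
     [0, 2 pi - theta] decides. *)
  intros s [j hj].
  destruct (main _ hj) as [k [hk [h1 h2]]]. exists k. split; [exact hk|].
  assert (hst : exists i, step b th d k (s + 2 * IZR j * PI) = step b th d k s + 2 * IZR i * PI).
  { unfold step. destruct Nat.eqb; rewrite !lift_period; eexists; reflexivity. }
  destruct hst as [i hi]. rewrite hi in h1, h2. split; [apply in_arc_period in h1; exact h1|].
  unfold weight, step_speed in *. rewrite lift_period, !dphase_period in h2. exact h2.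
Qed.

(** * Sensitivity and the Julia set *)

Lemma cos_lipschitz x y : Rabs (cos x - cos y) <= Rabs (x - y).
Proof.
  destruct (MVT_gen cos y x (fun c => - sin c)) as [c [_ e]].
  - intros z _. apply is_derive_Reals, derivable_pt_lim_cos.
  - intros z _. apply continuity_cos.
  - rewrite e, Rabs_mult.
    assert (Rabs (- sin c) <= 1) by (apply Rabs_le; generalize (SIN_bound c); lra).
    generalize (Rabs_pos (x - y)); nra.
Qed.

Lemma Rabs_sin_le x : Rabs (sin x) <= Rabs x.
Proof.
  rewrite <- cos_shift. rewrite <- (Rminus_0_r (cos _)), <- cos_PI2.
  eapply Rle_trans; [apply cos_lipschitz|]. right.
  rewrite <- Rabs_Ropp. f_equal; ring.
Qed.

Lemma phase_mvt_near b x y : 1 < b -> exists c, Rabs (x - c) <= Rabs (y - x) /\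
  Rabs (phase b y - phase b x) = dphase b c * Rabs (y - x).
Proof.
  intros hb. destruct (Rtotal_order x y) as [h | [<- | h]].
  - destruct (phase_mvt b x y hb h) as [c [hc e]]. exists c. split.
    + rewrite Rabs_left, Rabs_right; lra.
    + rewrite e, Rabs_mult, (Rabs_pos_eq (dphase b c)); [reflexivity|].
      left; apply dphase_pos; lra.
  - exists x. rewrite !Rminus_diag, Rabs_R0; lra.
  - destruct (phase_mvt b y x hb h) as [c [hc e]]. exists c. split.
    + rewrite Rabs_right, Rabs_left; lra.
    + rewrite <- Rabs_Ropp. replace (- (phase b y - phase b x)) with (phase b x - phase b y) by ring.
      rewrite e, Rabs_mult, (Rabs_pos_eq (dphase b c)).
      rewrite (Rabs_minus_sym x y); reflexivity.
      left; apply dphase_pos; lra.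
Qed.

Lemma dphase_ge_min b s : 1 < b -> (b - 1) / (b + 1) <= dphase b s.
Proof.
  intros hb. unfold dphase.
  replace ((b - 1) / (b + 1)) with ((b ^ 2 - 1) / (b + 1) ^ 2) by (field; lra).
  apply Rmult_le_compat_l; [nra|]. apply Rinv_le_contravar; [apply den2_pos; lra | apply den2_upper; lra].
Qed.

(** The ratio of slopes is the inverse ratio of the [den2] values, which are 2b-Lipschitz in the
    angle and at least (b-1)^2. *)
Lemma dphase_distortion b x y : 1 < b ->
  dphase b x <= (1 + 2 * b / (b - 1) ^ 2 * Rabs (x - y)) * dphase b y.
Proof.
  intros hb. assert (hx := den2_lower b x hb). assert (hy := den2_pos b y hb).
  assert (hx' := den2_pos b x hb). unfold dphase.
  assert (hb2 : 0 < (b - 1) ^ 2) by nra.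
  apply Rmult_le_reg_r with (den2 b x * den2 b y / (b ^ 2 - 1)).
  { apply Rdiv_lt_0_compat; nra. }
  replace ((b ^ 2 - 1) / den2 b x * (den2 b x * den2 b y / (b ^ 2 - 1))) with (den2 b y)
    by (field; split; nra).
  replace ((1 + 2 * b / (b - 1) ^ 2 * Rabs (x - y)) * ((b ^ 2 - 1) / den2 b y) * (den2 b x * den2 b y / (b ^ 2 - 1)))
    with (den2 b x + 2 * b * Rabs (x - y) * (den2 b x / (b - 1) ^ 2)) by (field; repeat split; nra).
  assert (h1 : 1 <= den2 b x / (b - 1) ^ 2).
  { apply Rmult_le_reg_r with ((b - 1) ^ 2); [lra|].
    replace (den2 b x / (b - 1) ^ 2 * (b - 1) ^ 2) with (den2 b x) by (field; lra). lra. }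
  assert (h2 := cos_lipschitz y x). assert (h3 := Rle_abs (cos y - cos x)).
  rewrite (Rabs_minus_sym y x) in h2.
  assert (h4 := Rabs_pos (x - y)).
  assert (den2 b y - den2 b x <= 2 * b * Rabs (x - y)).
  { unfold den2. assert (2 * b * (cos y - cos x) <= 2 * b * Rabs (x - y)); [|lra].
    apply Rmult_le_compat_l; lra. }
  assert (0 <= 2 * b * Rabs (x - y)) by nra.
  nra.
Qed.

Lemma lift_distance b th k x y :
  Rabs (lift b th k y - lift b th k x) = INR k * Rabs (phase b y - phase b x).
Proof.
  unfold lift. rewrite <- Rabs_Ropp.
  replace (- (- th - INR k * phase b y - (- th - INR k * phase b x)))
    with (INR k * (phase b y - phase b x)) by ring.
  rewrite Rabs_mult, (Rabs_pos_eq (INR k)); [reflexivity | apply pos_INR].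
Qed.

(** This prevents a small separation from jumping past half a turn in one step. *)
Lemma step_distance_upper b th d k x y : admissible b d -> (1 <= k <= d)%nat ->
  Rabs (step b th d k y - step b th d k x) <=
  INR d * ((b + 1) / (b - 1)) ^ 2 * Rabs (y - x).
Proof.
  intros hp hk. destruct (hp) as [hd2 hb _]. assert (hd := admissible_INR b d hp).
  set (K := (b + 1) / (b - 1)).
  assert (hK : 1 <= K).
  { unfold K. apply Rmult_le_reg_r with (b - 1); [lra|].
    replace ((b + 1) / (b - 1) * (b - 1)) with (b + 1) by (field; lra). lra. }
  assert (hl : forall j u v, (1 <= j <= d)%nat ->
    Rabs (lift b th j v - lift b th j u) <= INR j * K * Rabs (v - u)).
  { intros j u v hj. rewrite lift_distance.
    destruct (phase_mvt_near b u v hb) as [c [_ ->]].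
    rewrite Rmult_assoc. apply Rmult_le_compat_l; [apply pos_INR|].
    apply Rmult_le_compat_r; [apply Rabs_pos | apply dphase_le_max; lra]. }
  assert (hxy := Rabs_pos (y - x)).
  unfold step. destruct Nat.eqb.
  - eapply Rle_trans; [apply hl; lia|].
    apply Rmult_le_compat_r; [lra|]. apply Rmult_le_compat_l; [lra | nra].
  - eapply Rle_trans; [apply hl; lia|]. simpl INR.
    assert (h := hl k x y hk).
    assert (INR k <= INR d) by (apply le_INR; lia).
    assert (1 <= INR k) by (apply (le_INR 1); lia).
    assert (K * Rabs (lift b th k y - lift b th k x) <= K * (INR k * K * Rabs (y - x)))
      by (apply Rmult_le_compat_l; lra).
    assert (INR k * (K ^ 2 * Rabs (y - x)) <= INR d * (K ^ 2 * Rabs (y - x))).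
    { apply Rmult_le_compat_r; [nra | lra]. }
    lra.
Qed.

(** A step is at most two lifts, whence the square; after the first lift the points may be d
    (b+1)/(b-1) times further apart, whence that factor in the distortion bound. *)
Lemma step_distance_lower b th d k x y : admissible b d -> (1 <= k <= d)%nat ->
  step_speed b th d k x * Rabs (y - x) <=
  (1 + 2 * b / (b - 1) ^ 2 * (INR d * ((b + 1) / (b - 1))) * Rabs (y - x)) ^ 2 *
  Rabs (step b th d k y - step b th d k x).
Proof.
  intros hp hk. destruct (hp) as [hd2 hb _]. assert (hd := admissible_INR b d hp).
  set (K := (b + 1) / (b - 1)). set (C := 2 * b / (b - 1) ^ 2).
  assert (hC : 0 < C) by (apply Rdiv_lt_0_compat; nra).
  assert (hK : 1 <= K).
  { unfold K. apply Rmult_le_reg_r with (b - 1); [lra|].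
    replace ((b + 1) / (b - 1) * (b - 1)) with (b + 1) by (field; lra). lra. }
  assert (hxy := Rabs_pos (y - x)).
  set (r := 1 + C * (INR d * K) * Rabs (y - x)).
  assert (hr : 1 <= r).
  { unfold r. assert (0 <= C * (INR d * K) * Rabs (y - x)); [|lra].
    apply Rmult_le_pos; [apply Rmult_le_pos; [lra | nra] | lra]. }
  assert (hl : forall j u v, Rabs (v - u) <= INR d * K * Rabs (y - x) ->
    INR j * dphase b u * Rabs (v - u) <= r * Rabs (lift b th j v - lift b th j u)).
  { intros j u v huv. rewrite lift_distance.
    destruct (phase_mvt_near b u v hb) as [c [hc ->]].
    assert (h1 := dphase_distortion b u c hb). fold C in h1.
    assert (hj := pos_INR j). assert (hpos := dphase_pos b c hb).
    assert (h2 : dphase b u <= r * dphase b c).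
    { eapply Rle_trans; [exact h1|]. apply Rmult_le_compat_r; [lra|].
      unfold r. rewrite Rmult_assoc. apply Rplus_le_compat_l.
      apply Rmult_le_compat_l; lra. }
    replace (r * (INR j * (dphase b c * Rabs (v - u)))) with (INR j * (r * dphase b c) * Rabs (v - u)) by ring.
    apply Rmult_le_compat_r; [apply Rabs_pos|]. apply Rmult_le_compat_l; lra. }
  assert (hdK : 1 <= INR d * K) by nra.
  assert (h0 : Rabs (y - x) <= INR d * K * Rabs (y - x)) by nra.
  unfold step_speed, step. destruct Nat.eqb.
  - eapply Rle_trans; [apply hl; exact h0|].
    apply Rmult_le_compat_r; [apply Rabs_pos | nra].
  - assert (h1 := hl k x y h0).
    assert (h2 : Rabs (lift b th k y - lift b th k x) <= INR d * K * Rabs (y - x)).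
    { rewrite lift_distance. destruct (phase_mvt_near b x y hb) as [c [_ ->]].
      assert (INR k <= INR d) by (apply le_INR; lia).
      assert (hc := dphase_le_max b c hb). fold K in hc. assert (hc0 := dphase_pos b c hb).
      rewrite <- Rmult_assoc. apply Rmult_le_compat_r; [lra|].
      apply Rmult_le_compat; try lra. apply pos_INR. }
    assert (h3 := hl 1%nat _ _ h2). simpl INR in h3. rewrite Rmult_1_l in h3.
    assert (hpos := dphase_pos b (lift b th k x) hb).
    apply Rle_trans with (dphase b (lift b th k x) * (r * Rabs (lift b th k y - lift b th k x))).
    + replace (INR k * dphase b x * dphase b (lift b th k x) * Rabs (y - x))
        with (dphase b (lift b th k x) * (INR k * dphase b x * Rabs (y - x))) by ring.
      apply Rmult_le_compat_l; lra.
    + replace (r ^ 2) with (r * r) by ring.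
      rewrite Rmult_assoc.
      apply Rle_trans with (r * (dphase b (lift b th k x) * Rabs (lift b th k y - lift b th k x)));
        [right; ring|].
      apply Rmult_le_compat_l; lra.
Qed.

(** As long as the distance stays below eta, the weighted distance grows geometrically, yet weights
    at most 1 keep it below eta. *)
Lemma escape (delta w : nat -> R) g eta wmin : 1 < g -> 0 < wmin ->
  (forall n, wmin <= w n <= 1) -> 0 < delta 0%nat <= eta ->
  (forall n, delta n <= eta -> g * (w n * delta n) <= w (S n) * delta (S n)) ->
  exists n, delta n <= eta < delta (S n).
Proof.
  intros hg hw0 hw hd hstep.
  destruct (classic (exists n, delta n <= eta < delta (S n))) as [h|hn]; [exact h | exfalso].
  assert (hall : forall n, delta n <= eta).
  { induction n as [|n IH]; [lra|]. apply Rnot_lt_le; intros hlt. apply hn; exists n; lra. }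
  assert (hgrow : forall n, g ^ n * (w 0%nat * delta 0%nat) <= w n * delta n).
  { induction n as [|n IH]; [simpl; lra|]. eapply Rle_trans; [|apply hstep, hall].
    simpl. rewrite Rmult_assoc. apply Rmult_le_compat_l; lra. }
  assert (hpos : 0 < w 0%nat * delta 0%nat) by (generalize (hw 0%nat); nra).
  destruct (Pow_x_infinity g ltac:(rewrite Rabs_pos_eq; lra) ((eta + 1) / (w 0%nat * delta 0%nat)))
    as [N hN].
  specialize (hN N (le_n N)). rewrite Rabs_pos_eq in hN by (apply pow_le; lra).
  assert (h1 := hgrow N). assert (h2 := hall N). assert (h3 := hw N).
  assert (h4 : eta + 1 <= g ^ N * (w 0%nat * delta 0%nat)).
  { replace (eta + 1) with ((eta + 1) / (w 0%nat * delta 0%nat) * (w 0%nat * delta 0%nat)) by (field; split; intros hz; rewrite hz in hpos; lra).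
    apply Rmult_le_compat_r; lra. }
  destruct (Rle_dec 0 (delta N)); nra.
Qed.

Fixpoint step_iter (b th : R) (d : nat) (omega : nat -> nat) (n : nat) (s : R) : R :=
  match n with
  | O => s
  | S m => step b th d (omega m) (step_iter b th d omega m s)
  end.

Lemma fhat_iter_cis b d th omega n s : 1 < b ->
  fhat_iter b d (cis th) omega n (Fin (cis (- s))) =
  Fin (cis (- step_iter b th d omega n s)).
Proof.
  intros hb. induction n as [|n IH]; simpl; [reflexivity|].
  rewrite IH. unfold fhat, step, lift. destruct Nat.eqb; rewrite !fk_cis by lra; reflexivity.
Qed.

Lemma step_iter_continuous b th d omega n s : 1 < b ->
  continuity_pt (step_iter b th d omega n) s.
Proof.
  intros hb.
  assert (hl : forall k x, continuity_pt (lift b th k) x).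
  { intros k x. apply derivable_continuous_pt, ex_derive_Reals_0. unfold lift.
    apply @ex_derive_minus; [apply ex_derive_const|].
    apply ex_derive_scal. eexists; apply is_derive_phase; lra. }
  induction n as [|n IH]; simpl.
  - apply derivable_continuous_pt, derivable_pt_id.
  - apply (continuity_pt_comp _ (step b th d (omega n))); [exact IH|].
    unfold step. destruct Nat.eqb; [apply hl|].
    apply (continuity_pt_comp (lift b th (omega n)) (lift b th 1)); apply hl.
Qed.

Lemma step_iter_sensitive b d th q omega s : admissible b d -> 1 < q ->
  in_Omega d omega ->
  (forall n, q * weight b q d (step_iter b th d omega n s) <=
     weight b q d (step_iter b th d omega (S n) s) *
     step_speed b th d (omega n) (step_iter b th d omega n s)) ->
  exists eta, 0 < eta /\ forall eps, 0 < eps -> exists n y, Rabs (y - s) < eps /\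
    eta < Rabs (step_iter b th d omega n y - step_iter b th d omega n s) <= PI.
Proof.
  intros hp hq hom hexp. destruct (hp) as [hd2 hb _]. assert (hd := admissible_INR b d hp).
  assert (hpi := PI_RGT_0).
  set (K := (b + 1) / (b - 1)).
  assert (hK : 1 <= K).
  { unfold K. apply Rmult_le_reg_r with (b - 1); [lra|].
    replace ((b + 1) / (b - 1) * (b - 1)) with (b + 1) by (field; lra). lra. }
  set (C := 2 * b / (b - 1) ^ 2 * (INR d * K)).
  assert (hC : 0 < C).
  { unfold C. apply Rmult_lt_0_compat; [apply Rdiv_lt_0_compat; nra | nra]. }
  set (L := INR d * K ^ 2). assert (hL : 0 < L) by (unfold L; apply Rmult_lt_0_compat; nra).
  (* For sg <= 1, (1+sg)^2 <= 1 + 3 sg <= 1 + (q-1)/2 < q, so expansion survives the distortion. *)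
  set (sg := Rmin 1 ((q - 1) / 6)).
  assert (hsg : 0 < sg) by (apply Rmin_pos; lra).
  assert (hsg1 : sg <= 1) by apply Rmin_l. assert (hsg2 : sg <= (q - 1) / 6) by apply Rmin_r.
  clearbody sg.
  (* The first bound controls distortion up to distance eta; the second keeps the first distance
     beyond eta at most pi, so that the chord does not wrap around. *)
  set (eta := Rmin (sg / C) (PI / L)).
  assert (heta : 0 < eta) by (apply Rmin_pos; apply Rdiv_lt_0_compat; lra).
  assert (heta1 : C * eta <= sg).
  { apply Rle_trans with (C * (sg / C)); [apply Rmult_le_compat_l; [lra | apply Rmin_l]|].
    right; field; lra. }
  assert (heta2 : L * eta <= PI).
  { apply Rle_trans with (L * (PI / L)); [apply Rmult_le_compat_l; [lra | apply Rmin_r]|].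
    right; field; lra. }
  clearbody eta.
  exists eta; split; [exact heta|]. intros eps heps.
  set (y := s + Rmin (eps / 2) eta).
  assert (hm : 0 < Rmin (eps / 2) eta) by (apply Rmin_pos; lra).
  assert (hm1 := Rmin_l (eps / 2) eta). assert (hm2 := Rmin_r (eps / 2) eta).
  assert (hy : Rabs (y - s) = Rmin (eps / 2) eta).
  { unfold y. replace (s + Rmin (eps / 2) eta - s) with (Rmin (eps / 2) eta) by ring.
    apply Rabs_pos_eq; lra. }
  set (X := fun n => step_iter b th d omega n s).
  set (Y := fun n => step_iter b th d omega n y).
  set (wmin := Rmin 1 (INR d * ((b - 1) / (b + 1)) / q)).
  assert (hw0 : 0 < wmin).
  { apply Rmin_pos; [lra|]. apply Rdiv_lt_0_compat; [|lra].
    apply Rmult_lt_0_compat; [lra|]. apply Rdiv_lt_0_compat; lra. }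
  destruct (escape (fun n => Rabs (Y n - X n)) (fun n => weight b q d (X n)) (q / (1 + sg) ^ 2) eta wmin)
    as [n [hn1 hn2]].
  - apply Rmult_lt_reg_r with ((1 + sg) ^ 2); [nra|].
    replace (q / (1 + sg) ^ 2 * (1 + sg) ^ 2) with q by (field; lra). nra.
  - exact hw0.
  - intros n. split; [|apply Rmin_l]. unfold wmin, weight. apply Rle_min_compat_l.
    apply Rmult_le_compat_r; [left; apply Rinv_0_lt_compat; lra|].
    apply Rmult_le_compat_l; [lra | apply dphase_ge_min; lra].
  - unfold X, Y. simpl. rewrite hy. lra.
  - intros n hn.
    assert (h1 := step_distance_lower b th d (omega n) (X n) (Y n) hp (hom n)).
    fold K in h1. fold C in h1.
    change (step b th d (omega n) (X n)) with (X (S n)) in h1.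
    change (step b th d (omega n) (Y n)) with (Y (S n)) in h1.
    assert (h2 := hexp n). fold (X n) in h2. fold (X (S n)) in h2.
    set (dn := Rabs (Y n - X n)) in *. set (dn1 := Rabs (Y (S n) - X (S n))) in *.
    assert (hdn : 0 <= dn) by apply Rabs_pos. assert (hdn1 : 0 <= dn1) by apply Rabs_pos.
    assert (hwn : 0 < weight b q d (X (S n))).
    { apply Rmin_pos; [lra|]. apply Rdiv_lt_0_compat; [|lra].
      apply Rmult_lt_0_compat; [lra | apply dphase_pos; lra]. }
    set (v := step_speed b th d (omega n) (X n)) in *.
    set (w1 := weight b q d (X (S n))) in *. set (w0 := weight b q d (X n)) in *.
    apply Rmult_le_reg_r with ((1 + sg) ^ 2); [nra|].
    replace (q / (1 + sg) ^ 2 * (w0 * dn) * (1 + sg) ^ 2) with (q * w0 * dn) by (field; lra).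
    apply Rle_trans with (w1 * v * dn); [apply Rmult_le_compat_r; lra|].
    rewrite Rmult_assoc, Rmult_assoc. apply Rmult_le_compat_l; [lra|].
    eapply Rle_trans; [exact h1|]. rewrite Rmult_comm. apply Rmult_le_compat_l; [lra|].
    apply pow_incr. assert (C * dn <= C * eta) by (apply Rmult_le_compat_l; lra).
    assert (0 <= C * dn) by (apply Rmult_le_pos; lra). lra.
  - exists (S n), y. split; [lra|].
    split; [exact hn2|].
    assert (h := step_distance_upper b th d (omega n) (X n) (Y n) hp (hom n)).
    fold K in h. fold L in h.
    change (Rabs (Y (S n) - X (S n)) <= L * Rabs (Y n - X n)) in h.
    apply Rle_trans with (1 := h).
    apply Rle_trans with (L * eta); [apply Rmult_le_compat_l; lra | lra].
Qed.

(** * From sensitivity along the circle to failure of normality on the sphere *)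

Lemma chordal_unit z w : Cmod z = 1 -> Cmod w = 1 ->
  chordal (Fin z) (Fin w) = Cmod (z - w)%C.
Proof.
  intros hz hw. unfold chordal. rewrite hz, hw, pow1, sqrt_sqrt by lra. field.
Qed.

(** Infinity is at chordal distance sqrt 2 from the circle, so [x] is finite and bounded. This is
    applied to values of a limit function that need not lie on the circle. *)
Lemma chordal_unit_near z x e : Cmod z = 1 -> e <= 1 / 2 -> chordal (Fin z) x < e ->
  Cmod (z - fin_part x)%C <= 4 * e.
Proof.
  intros hz he h.
  assert (h2 : 0 < sqrt 2) by (apply sqrt_lt_R0; lra).
  assert (h3 : sqrt 2 <= 3 / 2).
  { rewrite <- (sqrt_pow2 (3 / 2)) by lra. apply sqrt_le_1; lra. }
  destruct x as [w|]; unfold chordal in h; rewrite hz, pow1 in h;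
    replace (1 + 1) with 2 in h by ring.
  - simpl fin_part.
    assert (hm := Cmod_ge_0 (z - w)%C). assert (hw := Cmod_ge_0 w).
    assert (hs : 1 <= sqrt (1 + Cmod w ^ 2)).
    { rewrite <- sqrt_1 at 1. apply sqrt_le_1; nra. }
    assert (hs' : sqrt (1 + Cmod w ^ 2) <= 1 + Cmod w).
    { rewrite <- (sqrt_pow2 (1 + Cmod w)) by lra. apply sqrt_le_1; nra. }
    assert (hw' : Cmod w <= 1 + Cmod (z - w)%C).
    { assert (k := Cmod_triangle z (- (z - w))%C).
      replace (z + - (z - w))%C with w in k by ring. rewrite Cmod_opp in k. lra. }
    set (t := sqrt (1 + Cmod w ^ 2)) in *. set (m := Cmod (z - w)%C) in *.
    assert (hlt : 2 * m < e * (sqrt 2 * t)).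
    { apply Rmult_lt_compat_r with (r := sqrt 2 * t) in h; [|nra].
      replace (2 * m / (sqrt 2 * t) * (sqrt 2 * t)) with (2 * m) in h by (field; lra). exact h. }
    assert (he0 : 0 < e) by (assert (0 < sqrt 2 * t) by nra; nra).
    assert (sqrt 2 * t <= 3 / 2 * (2 + m)) by (apply Rmult_le_compat; lra).
    assert (e * (sqrt 2 * t) <= e * (3 / 2 * (2 + m))) by (apply Rmult_le_compat_l; lra).
    nra.
  - exfalso. assert (1 < 2 / sqrt 2); [|lra].
    apply Rmult_lt_reg_r with (sqrt 2); [lra|].
    replace (2 / sqrt 2 * sqrt 2) with 2 by (field; lra). lra.
Qed.

Lemma cis_lipschitz x y : Cmod (cis x - cis y)%C <= Rabs (x - y).
Proof.
  rewrite Cmod_cis_minus. assert (h := Rabs_sin_le ((x - y) / 2)).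
  unfold Rdiv in *. rewrite (Rabs_mult (x - y)), (Rabs_pos_eq (/ 2)) in h by lra. lra.
Qed.

Lemma Cmod_dist_triangle x y z : Cmod (x - z)%C <= Cmod (x - y)%C + Cmod (y - z)%C.
Proof. replace (x - z)%C with ((x - y) + (y - z))%C by ring. apply Cmod_triangle. Qed.

Lemma Cmod_dist_sym x y : Cmod (x - y)%C = Cmod (y - x)%C.
Proof. rewrite <- Cmod_opp. f_equal. ring. Qed.

(** The limit g is not known to be continuous, so one fixed member of the subsequence, continuous at
    s, serves as intermediary between late members at t and at s. *)
Lemma julia_of_sensitive (F : nat -> sphere -> sphere) (G : nat -> R -> R) s c :
  (forall n t, F n (Fin (cis (- t))) = Fin (cis (- G n t))) ->
  (forall n, continuity_pt (G n) s) -> 0 < c ->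
  (forall eps, 0 < eps -> exists n t, Rabs (t - s) < eps /\
     c <= Cmod (cis (- G n t) - cis (- G n s))%C) ->
  Julia F (Fin (cis (- s))).
Proof.
  intros hF hG hc hsens [U [hU [hUs hnorm]]].
  assert (hch : forall j : nat, exists p : nat * R, Rabs (snd p - s) < / (INR j + 1) /\
     c <= Cmod (cis (- G (fst p) (snd p)) - cis (- G (fst p) s))%C).
  { intros j. destruct (hsens (/ (INR j + 1))) as (n & t & h1 & h2).
    - apply Rinv_0_lt_compat. generalize (pos_INR j); lra.
    - exists (n, t). split; assumption. }
  pose (p := fun j => proj1_sig (constructive_indefinite_description _ (hch j))).
  assert (hp : forall j, Rabs (snd (p j) - s) < / (INR j + 1) /\
     c <= Cmod (cis (- G (fst (p j)) (snd (p j))) - cis (- G (fst (p j)) s))%C).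
  { intros j. exact (proj2_sig (constructive_indefinite_description _ (hch j))). }
  clearbody p.
  (* The separation times need not increase; normality is available along any sequence of
     indices. *)
  destruct (hnorm (fun j => fst (p j))) as (phi & g & hphi & hcv).
  destruct (hU _ hUs) as (r0 & hr0 & hball).
  destruct (hcv _ hUs) as (r & hr & hunif).
  (* Four comparisons with g cost 16 e <= 2c/5, and the continuity of the fixed member costs c/2:
     less than c in total. *)
  set (e := Rmin (1 / 2) (c / 40)).
  assert (he : 0 < e) by (apply Rmin_pos; lra).
  assert (he1 : e <= 1 / 2) by apply Rmin_l. assert (he2 : e <= c / 40) by apply Rmin_r.
  destruct (hunif e he) as [N hN].
  assert (hphi_ge : forall i, (i <= phi i)%nat).
  { induction i as [|i IH]; [lia|]. assert (k := hphi i (S i) (Nat.lt_succ_diag_r i)). lia. }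
  set (rm := Rmin r0 r). assert (hrm : 0 < rm) by (apply Rmin_pos; lra).
  assert (hclose : forall i t, (N <= i)%nat -> Rabs (t - s) < rm ->
    Cmod (cis (- G (fst (p (phi i))) t) - fin_part (g (Fin (cis (- t)))))%C <= 4 * e).
  { intros i t hi ht.
    assert (hd : chordal (Fin (cis (- s))) (Fin (cis (- t))) < rm).
    { rewrite chordal_unit by apply Cmod_cis. eapply Rle_lt_trans; [apply cis_lipschitz|].
      replace (- s - - t) with (t - s) by ring. exact ht. }
    apply chordal_unit_near; [apply Cmod_cis | exact he1 |].
    rewrite <- hF. apply hN; [exact hi | apply hball |];
      apply Rlt_le_trans with (1 := hd); [apply Rmin_l | apply Rmin_r]. }
  set (M := fst (p (phi N))).
  destruct (hG M (c / 2) ltac:(lra)) as (al & hal & hcont).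
  set (eps := Rmin rm al). assert (heps : 0 < eps) by (apply Rmin_pos; lra).
  destruct (archimed_cor1 eps heps) as [J [hJ1 hJ2]].
  set (i := Nat.max N J).
  assert (hi : (N <= i)%nat) by apply Nat.le_max_l.
  destruct (hp (phi i)) as [h1 h2].
  set (t := snd (p (phi i))) in *.
  assert (ht : Rabs (t - s) < eps).
  { apply Rlt_trans with (1 := h1). apply Rle_lt_trans with (2 := hJ1).
    apply Rinv_le_contravar; [apply lt_0_INR; lia|].
    assert (INR J <= INR (phi i)); [|lra]. apply le_INR.
    assert (k := hphi_ge i). assert (J <= i)%nat by apply Nat.le_max_r. lia. }
  assert (ht1 : Rabs (t - s) < rm) by (apply Rlt_le_trans with (1 := ht); apply Rmin_l).
  assert (ht2 : Rabs (t - s) < al) by (apply Rlt_le_trans with (1 := ht); apply Rmin_r).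
  assert (hs0 : Rabs (s - s) < rm) by (rewrite Rminus_diag, Rabs_R0; lra).
  assert (hGM : Cmod (cis (- G M t) - cis (- G M s))%C < c / 2).
  { eapply Rle_lt_trans; [apply cis_lipschitz|].
    replace (- G M t - - G M s) with (- (G M t - G M s)) by ring. rewrite Rabs_Ropp.
    destruct (Req_dec t s) as [->|hne]; [rewrite Rminus_diag, Rabs_R0; lra|].
    apply hcont. split; [split; [exact I | auto] | exact ht2]. }
  assert (c1 := hclose i t hi ht1). assert (c2 := hclose i s hi hs0).
  assert (c3 := hclose N t (le_n N) ht1). assert (c4 := hclose N s (le_n N) hs0).
  fold M in c3, c4.
  set (A := cis (- G (fst (p (phi i))) t)) in *.
  set (B := cis (- G (fst (p (phi i))) s)) in *.
  set (A' := cis (- G M t)) in *. set (B' := cis (- G M s)) in *.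
  set (a := fin_part (g (Fin (cis (- t))))) in *.
  set (b := fin_part (g (Fin (cis (- s))))) in *.
  assert (d1 := Cmod_dist_triangle A a B). assert (d2 := Cmod_dist_triangle a A' B).
  assert (d3 := Cmod_dist_triangle A' B' B). assert (d4 := Cmod_dist_triangle B' b B).
  rewrite (Cmod_dist_sym a A') in d2. rewrite (Cmod_dist_sym b B) in d4. lra.
Qed.

Lemma Arc_cc_lift th s : 0 < th < PI -> in_arc th s -> Arc_cc (cis th) (RtoC 1) (cis (- s)).
Proof.
  intros hth [j hj]. exists th, (2 * PI), (2 * PI - (s + 2 * IZR j * PI)).
  split; [reflexivity|]. split.
  { rewrite <- cis_0. replace (2 * PI) with (0 + 2 * IZR 1 * PI) by (simpl; ring).
    rewrite cis_period; reflexivity. }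
  split; [lra|]. split; [lra|].
  replace (2 * PI - (s + 2 * IZR j * PI))
    with (- s + 2 * IZR (1 - j) * PI) by (rewrite minus_IZR; simpl; ring).
  rewrite cis_period; reflexivity.
Qed.

Lemma Arc_cc_in_arc th z : 0 < th < PI -> Arc_cc (cis th) (RtoC 1) z ->
  exists s, z = cis (- s) /\ in_arc th s.
Proof.
  intros hth (s & s' & t & h1 & h2 & h3 & h4 & ->).
  destruct (cis_inj _ _ h1) as [j hj]. rewrite <- cis_0 in h2.
  destruct (cis_inj _ _ h2) as [m hm].
  exists (- t). split; [rewrite Ropp_involutive; reflexivity|].
  assert (hpi := PI_RGT_0).
  (* The lifted arc has length 2 pi (j - m) - theta, which must lie in [0, 2 pi). *)
  assert (e : (j - m = 1)%Z).
  { assert (k1 : IZR (j - m) < 2) by (rewrite minus_IZR; nra).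
    assert (k2 : 0 < IZR (j - m)) by (rewrite minus_IZR; nra).
    apply lt_IZR in k1. apply lt_IZR in k2. lia. }
  assert (e' : IZR j = IZR m + 1) by (rewrite <- (plus_IZR m 1); f_equal; lia).
  exists (- m)%Z. rewrite opp_IZR, e' in *. lra.
Qed.

Lemma Arc_co_angle t0 t1 l : 0 < t0 -> t0 <= t1 < PI -> Arc_co (cis t0) (cis t1) l ->
  exists th, l = cis th /\ t0 <= th < PI.
Proof.
  intros h0 h01 (s & s' & t & h1 & h2 & h3 & h4 & ->).
  destruct (cis_inj _ _ h1) as [j hj]. destruct (cis_inj _ _ h2) as [m hm].
  assert (hpi := PI_RGT_0).
  exists (t + 2 * IZR j * PI). split; [rewrite cis_period; reflexivity|].
  assert (e : j = m).
  { assert (k1 : IZR (j - m) < 1) by (rewrite minus_IZR; nra).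
    assert (k2 : -1 < IZR (j - m)) by (rewrite minus_IZR; nra).
    apply lt_IZR in k1. apply lt_IZR in k2. lia. }
  subst m. lra.
Qed.

Theorem proposition5p16 :
  forall (d : nat) (b : R) (lambda0 lambda1 lambda : C),
    (2 <= d)%nat ->
    (1 < b < (INR d + 1) / (INR d - 1))%R ->
    is_lambda0 b d lambda0 ->
    is_lambda1 b d lambda1 ->
    Arc_co lambda0 lambda1 lambda ->
    forall z : C, Arc_cc lambda (RtoC 1) z ->
      exists omega : nat -> nat,
        in_Omega d omega /\
        Julia (fhat_iter b d lambda omega) (Fin z) /\
        forall n : nat,
          exists w : C,
            fhat_iter b d lambda omega n (Fin z) = Fin w /\
            Arc_cc lambda (RtoC 1) w.
Proof.
  intros d b lambda0 lambda1 lambda hd hbd hl0 hl1 hl z hz.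
  assert (hp := admissible_intro b d hd hbd). assert (hb := admissible_b b d hp).
  destruct (is_lambda0_spec b d lambda0 hp hl0) as (t0 & -> & h0).
  destruct (is_lambda1_spec b d lambda1 t0 hp h0 hl1) as (t1 & -> & h01).
  destruct (theta0_range b d t0 h0) as [h0pos _].
  destruct (Arc_co_angle t0 t1 lambda h0pos h01 hl) as (th & -> & hth).
  destruct (Arc_cc_in_arc th z ltac:(lra) hz) as (s & -> & hs).
  destruct (expanding_step b d t0 th hp h0 hth) as (q & hq & hstep).
  assert (hch : forall x, exists k, in_arc th x -> (1 <= k <= d)%nat /\
    in_arc th (step b th d k x) /\
    q * weight b q d x <= weight b q d (step b th d k x) * step_speed b th d k x).
  { intros x. destruct (classic (in_arc th x)) as [h|h].
    - destruct (hstep x h) as [k hk]. exists k; auto.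
    (* A default letter outside the arc, which the orbit never visits. *)
    - exists 0%nat; contradiction. }
  pose (kk := fun x => proj1_sig (constructive_indefinite_description _ (hch x))).
  assert (hkk : forall x, in_arc th x -> (1 <= kk x <= d)%nat /\
    in_arc th (step b th d (kk x) x) /\
    q * weight b q d x <= weight b q d (step b th d (kk x) x) * step_speed b th d (kk x) x).
  { intros x. exact (proj2_sig (constructive_indefinite_description _ (hch x))). }
  clearbody kk.
  (* The orbit is built first, each letter being chosen from the current point; the sequence omega
     is then read off it. *)
  pose (orbit := fun n => Nat.iter n (fun x => step b th d (kk x) x) s).
  pose (omega := fun n => kk (orbit n)).
  assert (horb : forall n, step_iter b th d omega n s = orbit n).
  { induction n as [|n IH]; [reflexivity|]. simpl step_iter. rewrite IH. reflexivity. }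
  assert (harc : forall n, in_arc th (orbit n)).
  { induction n as [|n IH]; [exact hs|]. apply (hkk _ IH). }
  assert (hom : in_Omega d omega) by (intros n; apply hkk, harc).
  exists omega. split; [exact hom|]. split.
  - destruct (step_iter_sensitive b d th q omega s hp hq hom) as (eta & heta & hsens).
    { intros n. rewrite !horb. apply (hkk _ (harc n)). }
    assert (hpi := PI_RGT_0).
    destruct (Rlt_dec eta PI) as [hlt | hge].
    2:{ destruct (hsens 1 Rlt_0_1) as (n & y & _ & h). lra. }
    (* The constant is the chord of an arc of angle eta; angles between eta and pi have at least
       that chord. *)
    apply (julia_of_sensitive _ (step_iter b th d omega) s (2 * sin (eta / 2))).
    + intros n t. apply fhat_iter_cis, hb.
    + intros n. apply step_iter_continuous, hb.
    + assert (0 < sin (eta / 2)) by (apply sin_gt_0; lra). lra.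
    + intros eps heps. destruct (hsens eps heps) as (n & y & h1 & h2 & h3).
      exists n, y. split; [exact h1|]. rewrite Cmod_cis_minus.
      apply Rmult_le_compat_l; [lra|].
      set (D := step_iter b th d omega n y - step_iter b th d omega n s) in *.
      replace ((- step_iter b th d omega n y - - step_iter b th d omega n s) / 2) with (- (D / 2))
        by (unfold D; field).
      rewrite sin_neg, Rabs_Ropp.
      assert (hab : Rabs (sin (D / 2)) = sin (Rabs D / 2)).
      { destruct (Rle_dec 0 D) as [c|c].
        - rewrite (Rabs_pos_eq D) in * by lra. apply Rabs_pos_eq, sin_ge_0; lra.
        - rewrite (Rabs_left D) in * by lra. replace (- D / 2) with (- (D / 2)) by field.
          rewrite sin_neg, <- Rabs_Ropp. apply Rabs_pos_eq.
          rewrite <- sin_neg. apply sin_ge_0; lra. }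
      rewrite hab. apply sin_incr_1; lra.
  - intros n. exists (cis (- orbit n)). rewrite fhat_iter_cis, horb by exact hb.
    split; [reflexivity|]. apply Arc_cc_lift; [lra | apply harc].
Qed.
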